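(* Consider a stationary $GI/GI/1$ queue with load $\rho<1$ and light-tailed service times, and suppose that the service time $B$ has a density. For $y>0$ let $\gamma_p^y$ be the decay rate of the busy period in the queue with service times $B^y=B\,I(B<y)$ (this is also the decay rate of the sojourn time under preemptive shortest remaining processing time (SRPT) of a customer with service time $y$). Let $\gamma_p$ be the decay rate of the busy period in the original queue, and let $\gamma_w$ be the decay rate of the steady-state workload at arrival epochs (this is also the decay rate of the sojourn time under FIFO). Then $\gamma_p^y$ is continuous and strictly decreasing in $y$, it converges to $\gamma_p<\gamma_w$ as $y\to\infty$, and $\gamma_p^y\to\infty$ as $y\to0$. Hence there exists a critical value $y^*$ for which $$\gamma_p^{y^*}=\gamma_w,$$ and, with the decay rate as performance measure, SRPT is better than FIFO for customers with service time $y$ below $y^*$ (that is, $\gamma_p^y>\gamma_w$ for $y<y^*$), and worse than FIFO for customers with service time $y$ larger than $y^*$ (that is, $\gamma_p^y<\gamma_w$ for $y>y^*$).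
   Context: Queue: single server working at unit speed; i.i.d. inter-arrival times distributed as $A$ and, independently, i.i.d. service times distributed as $B$. Standing assumptions: $\rho=\mathbb{E}\{B\}/\mathbb{E}\{A\}<1$; $\mathbb{P}\{B>A\}>0$; $B$ is light-tailed, i.e. $\mathbb{E}\{e^{sB}\}$ is finite for $s$ in a neighborhood of $0$. The decay rate of a random variable $U$ is the number $\gamma_u$ with $\log\mathbb{P}\{U>x\}=-\gamma_u x+o(x)$ as $x\to\infty$. With $\Phi_X(s)=\mathbb{E}\{e^{sX}\}$ and $\Phi_A^{-1}$ the inverse function of $\Phi_A$, the decay rates are $$\gamma_w=\sup\{s:\Phi_A(-s)\Phi_B(s)\le1\},\qquad \gamma_p=\sup_{s\ge0}\left\{s+\Phi_A^{-1}\!\left(\frac1{\Phi_{B}(s)}\right)\right\},\qquad \gamma_p^y=\sup_{s\ge0}\left\{s+\Phi_A^{-1}\!\left(\frac1{\Phi_{B^y}(s)}\right)\right\}.$$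
   Formalization: Strict decrease from y1 to y2 is claimed only if P(y1≤B<y2)>0 and P(B^{y2}>A)>0 (else nonincreasing), and strict comparison with γ_w only if B has mass between y and y*; as stated it fails, e.g. for B uniform on [0,1], y≥1. Rates may be +∞. *)

(* Defs.v *)
From HB Require Import structures.
From mathcomp Require Import all_boot all_order all_algebra.
From mathcomp Require Import all_classical all_reals all_analysis.

Set Implicit Arguments.
Unset Strict Implicit.
Unset Printing Implicit Defensive.

Import Order.TTheory GRing.Theory Num.Theory.
Import numFieldNormedType.Exports.

Local Open Scope classical_set_scope.
Local Open Scope ring_scope.
Local Open Scope ereal_scope.

(* The transform Phi_X(s) = E(e^{sX}) is the moment generating function
   'M_P X s, with values in [0, +oo]. *)

Definition independent_RVs d (T : measurableType d) (R : realType)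
    (P : probability T R) (X Y : {RV P >-> R}) :=
  forall U V : set R, measurable U -> measurable V ->
    P (X @^-1` U `&` Y @^-1` V) = P (X @^-1` U) * P (Y @^-1` V).

Definition light_tailed d (T : measurableType d) (R : realType)
    (P : probability T R) (X : T -> R) :=
  exists2 e : R, (0 < e)%R & forall s : R, (`|s| < e)%R -> 'M_P X s < +oo.

Definition has_density d (T : measurableType d) (R : realType)
    (P : probability T R) (X : {RV P >-> R}) :=
  exists f : R -> R,
    [/\ measurable_fun [set: R] f,
        forall x, (0 <= f x)%R
      & forall U : set R, measurable U ->
          distribution P X U = \int[lebesgue_measure]_(x in U) (f x)%:E].

(* The load E(B) / E(A); the value of x / +oo is 0, and x / 0 is +oo for
   x > 0. *)
Definition load d (T : measurableType d) (R : realType)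
    (P : probability T R) (A B : T -> R) : \bar R :=
  'E_P[B] / 'E_P[A].

(* B^y = B I(B < y) *)
Definition truncated d (T : measurableType d) (R : realType)
    (B : T -> R) (y : R) : T -> R :=
  fun w => (B w * \1_[set w' | (B w' < y)%R] w)%R.

(* The inverse function of s |-> Phi_X(s).  When X >= 0 is not a.s. zero,
   Phi_X is strictly increasing where it is finite, so for 0 < u < +oo the
   set below has at most one element; the value is -oo if u is not attained,
   in particular if u = 0. *)
Definition mgf_inv d (T : measurableType d) (R : realType)
    (P : probability T R) (X : T -> R) (u : \bar R) : \bar R :=
  ereal_sup [set t%:E | t in [set t : R | 'M_P X t = u]].

(* Decay rate of the steady-state workload at arrival epochs:
   sup {s : Phi_A(-s) Phi_B(s) <= 1}. *)
Definition workload_decay d (T : measurableType d) (R : realType)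
    (P : probability T R) (A B : T -> R) : \bar R :=
  ereal_sup [set s%:E | s in [set s : R | 'M_P A (- s)%R * 'M_P B s <= 1]].

(* Decay rate of the busy period:
   sup_{s >= 0} (s + Phi_A^{-1}(1 / Phi_B(s))).
   Points s at which Phi_B(s) = +oo or 1 / Phi_B(s) is not a value of Phi_A
   contribute -oo.  The supremum can be +oo: this happens when B is replaced
   by a truncation B^y with P(B^y > A) = 0, since busy periods then have
   bounded length. *)
Definition busy_decay d (T : measurableType d) (R : realType)
    (P : probability T R) (A B : T -> R) : \bar R :=
  ereal_sup [set s%:E + mgf_inv P A ('M_P B s)^-1 | s in [set s : R | (0 <= s)%R]].

(* Main.v *)
Require Import Defs.
From HB Require Import structures.
From mathcomp Require Import all_boot all_order all_algebra.
From mathcomp Require Import all_classical all_reals all_analysis.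
From mathcomp Require Import measurable_realfun ring lra.

Import Order.TTheory GRing.Theory Num.Theory.
Import numFieldNormedType.Exports.

Local Open Scope classical_set_scope.
Local Open Scope ring_scope.
Local Open Scope ereal_scope.

(* Since Phi_A is increasing, the busy period decay rate of the queue with
   service times X is the supremum of all r such that, for some s >= 0,
     E e^{(r - s) A} E e^{s X} <= 1.
   As X grows this condition becomes more demanding.  As soon as work can build
   up, such an s is bounded uniformly over r >= 0 and over all larger service
   times, so Fatou's lemma along a convergent subsequence of witnesses gives
   left continuity in the truncation level, the limit at +oo, and attainment of
   the supremum.  Right continuity is dominated convergence together with the
   absence of atoms of B.  If work cannot build up, then X <= b <= A almost
   surely for some constant b, and the absence of an atom of X at b > 0 makes
   the decay rate infinite, so there is no jump at the threshold.  At an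
   attained pair (r, s) the load condition forces r > 0, hence s > r, and
   truncating further makes the inequality strict, which leaves room to
   increase r.  The same pair gives s <= gamma_w, hence gamma_p < gamma_w. *)

(** * Moment generating functions *)

Section mgf.
Context {d} {T : measurableType d} {R : realType} (P : probability T R).
Implicit Types (X Y : T -> R) (s t : R).

Lemma mgfE X s : 'M_P X s = \int[P]_w (expR (X w * s))%:E.
Proof. by rewrite /mmt_gen_fun unlock. Qed.

Lemma measurable_exp_mul X s : measurable_fun setT X ->
  measurable_fun setT (fun w => (expR (X w * s))%:E).
Proof.
move=> mX; apply/measurable_EFinP; apply: measurableT_comp => //.
exact: measurable_funM.
Qed.

Lemma mgf_ge0 X s : 0 <= 'M_P X s.
Proof. by rewrite mgfE integral_ge0// => w _; rewrite lee_fin expR_ge0. Qed.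

Lemma mgf0 X : 'M_P X 0 = 1.
Proof.
rewrite mgfE; under eq_integral do rewrite mulr0 expR0.
by rewrite integral_cst// [X in _ * X]probability_setT mul1e.
Qed.

(** Comparing the exponents themselves covers monotonicity in the random variable and in the
    parameter at once, for parameters of either sign. *)
Lemma mgf_le X Y s t : measurable_fun setT X -> measurable_fun setT Y ->
  (forall w, X w * s <= Y w * t)%R -> 'M_P X s <= 'M_P Y t.
Proof.
move=> mX mY XY; rewrite !mgfE; apply: ge0_le_integral => //.
- exact: measurable_exp_mul.
- exact: measurable_exp_mul.
- by move=> w _; rewrite lee_fin ler_expR.
Qed.

(** If the two transforms were equal, finiteness would allow subtraction, so the nonnegative
    difference of the exponentials would have integral 0 and vanish almost surely. *)
Lemma mgf_lt X Y s t : measurable_fun setT X -> measurable_fun setT Y ->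
  (forall w, X w * s <= Y w * t)%R ->
  0 < P [set w | (X w * s < Y w * t)%R] ->
  'M_P X s < +oo -> 'M_P X s < 'M_P Y t.
Proof.
move=> mX mY XY P0 Xoo; rewrite lt_neqAle mgf_le// andbT; apply/negP => /eqP e.
pose g := fun w => (expR (Y w * t) - expR (X w * s))%R.
have mg : measurable_fun setT (EFin \o g).
  by apply/measurable_EFinP; apply: measurable_funB; apply/measurable_EFinP;
    exact: measurable_exp_mul.
have g0 w : (0 <= g w)%R by rewrite subr_ge0 ler_expR.
have : 'M_P Y t = 'M_P X s + \int[P]_w (g w)%:E.
  rewrite !mgfE -ge0_integralD//.
  - by apply: eq_integral => w _; rewrite -EFinD /g addrC subrK.
  - exact: measurable_exp_mul.
  - by move=> w _; rewrite lee_fin.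
have Xf : 'M_P X s \is a fin_num by rewrite ge0_fin_numE// mgf_ge0.
rewrite -e => /eqP; rewrite -[eqbLHS]adde0 eq_sym; move=> /eqP h.
have {h} ig : \int[P]_w (g w)%:E = 0.
  by move: h; rewrite adde0 => /(congr1 (fun x => x - 'M_P X s)); rewrite addeAC subee// add0e.
have : \int[P]_w `|(EFin \o g) w| = 0.
  by rewrite -[RHS]ig; apply: eq_integral => w _ /=; rewrite ger0_norm.
move=> /(ae_eq_integral_abs P measurableT mg)[N [mN N0 gN]].
have : P [set w | (X w * s < Y w * t)%R] <= P N.
  apply: le_measure; rewrite ?inE//.
    rewrite -[X in measurable X]setTI; apply: measurable_fun_ltr => //;
      exact: measurable_funM.
  move=> w /= h; apply: gN => /= /(_ I) [] /eqP.
  by rewrite subr_eq0 => /eqP /expR_inj e'; rewrite e' ltxx in h.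
by rewrite N0 leNgt P0.
Qed.

Lemma mgf_gt0 X s : measurable_fun setT X -> 0 < 'M_P X s.
Proof.
move=> mX; rewrite lt_neqAle mgf_ge0 andbT; apply/negP => /eqP e.
have : \int[P]_w `|(expR (X w * s))%:E| = 0.
  rewrite e mgfE; apply: eq_integral => w _ /=; rewrite ger0_norm//.
move=> /(ae_eq_integral_abs P measurableT (measurable_exp_mul X s mX)).
move=> [N [mN N0 gN]]; have : P setT <= P N.
  apply: le_measure; rewrite ?inE//.
  move=> w _; apply: gN => /= /(_ I) [] /eqP.
  by rewrite gt_eqF// expR_gt0.
by rewrite N0 probability_setT leNgt lte01.
Qed.

(** Fatou's lemma asks for no dominating function. The bounds [c_ n] vary because they will be
    reciprocals of transforms of the inter-arrival time. *)
Lemma mgf_fatou (X_ : (T -> R)^nat) X (s_ : R^nat) s (c_ : R^nat) (c : R) :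
  (forall n, measurable_fun setT (X_ n)) -> measurable_fun setT X ->
  (forall w, X_ n w * s_ n @[n --> \oo] --> X w * s)%R ->
  (forall n, 'M_P (X_ n) (s_ n) <= (c_ n)%:E) ->
  (c_ n @[n --> \oo] --> c)%R -> 'M_P X s <= c%:E.
Proof.
move=> mX_ mX cX hc cc.
have := fatou P measurableT
  (f := fun n w => (expR (X_ n w * s_ n))%:E)
  (fun n => measurable_exp_mul _ _ (mX_ n)).
move=> /(_ (fun n w _ => _)) h.
have {}h := h (fun n w => expR_ge0 _).
apply: (@le_trans _ _ (\int[P]_w limn_einf (fun n => (expR (X_ n w * s_ n))%:E))).
  rewrite mgfE le_eqVlt; apply/orP; left; apply/eqP; apply: eq_integral => w _.
  have cw : (expR (X_ n w * s_ n))%:E @[n --> \oo] --> (expR (X w * s))%:E.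
    apply: cvg_EFin; first exact: nearW.
    by apply: continuous_cvg; [exact: continuous_expR|exact: cX].
  by rewrite (cvg_limn_einf_sup cw).1.
apply: (le_trans h).
have cE : (c_ n)%:E @[n --> \oo] --> c%:E.
  by apply: cvg_EFin => //; exact: nearW.
rewrite -(cvg_limn_einf_sup cE).1 !limn_einf_lim.
apply: lee_lim; [exact: is_cvg_einfs|exact: is_cvg_einfs|].
apply: nearW => n; rewrite /einfs; apply: le_ereal_inf_tmp => _ [m /= nm <-].
apply: ge_ereal_inf; exists ('M_P (X_ m) (s_ m)) => //.
by exists m => //; rewrite mgfE.
Qed.

(** Dominated convergence with the constant [expR K]. Almost sure convergence is the right form for
    truncations from the right, which may fail to converge where [B] equals the level. *)
Lemma mgf_cvg (X_ : (T -> R)^nat) X (s_ : R^nat) s (K : R) :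
  (forall n, measurable_fun setT (X_ n)) -> measurable_fun setT X ->
  {ae P, forall w, X_ n w * s_ n @[n --> \oo] --> X w * s}%R ->
  (forall n w, X_ n w * s_ n <= K)%R ->
  'M_P (X_ n) (s_ n) @[n --> \oo] --> 'M_P X s.
Proof.
move=> mX_ mX cX hK.
have [] := @dominated_convergence _ _ _ P setT measurableT
  (fun n w => (expR (X_ n w * s_ n))%:E) (fun w => (expR (X w * s))%:E)
  (cst (expR K)%:E).
- by move=> n; exact: measurable_exp_mul.
- exact: measurable_exp_mul.
- apply: filterS cX => w cw _.
  apply: cvg_EFin; first exact: nearW.
  by apply: continuous_cvg; [exact: continuous_expR|exact: cw].
- exact: finite_measure_integrable_cst.
- apply: aeW => w n _ /=; rewrite lee_fin ger0_norm ?expR_ge0// ler_expR.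
  exact: hK.
move=> _ _; rewrite mgfE.
rewrite (_ : (fun n => 'M_P _ _) = fun n => \int[P]_w (expR (X_ n w * s_ n))%:E)//.
by apply/funext => n; rewrite mgfE.
Qed.

(** Markov's inequality for e^{sX}, used here to bound transforms from below. *)
Lemma mgf_markov X s (a : R) : measurable_fun setT X ->
  (expR a)%:E * P [set w | (a <= X w * s)%R] <= 'M_P X s.
Proof.
move=> mX; set E := [set w | _].
have mE : measurable E.
  rewrite -[E]setTI; apply: measurable_fun_ler => //; exact: measurable_funM.
rewrite -integral_cst// mgfE integral_mkcond; apply: ge0_le_integral => //.
- by move=> w _; rewrite patchE; case: ifP => // _; rewrite lee_fin expR_ge0.
- by rewrite -measurable_restrictT.
- exact: measurable_exp_mul.
- move=> w _; rewrite patchE; case: ifPn => [|_]; last by rewrite lee_fin expR_ge0.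
  by rewrite inE /E /= lee_fin ler_expR.
Qed.

Lemma mgf_ge1 X s : measurable_fun setT X -> (forall w, 0 <= X w)%R ->
  (0 <= s)%R -> 1 <= 'M_P X s.
Proof.
by move=> mX X0 s0; rewrite -(mgf0 X) mgf_le// => w; rewrite mulr0 mulr_ge0.
Qed.

Lemma mgf_le1 X s : measurable_fun setT X -> (forall w, 0 <= X w)%R ->
  (s <= 0)%R -> 'M_P X s <= 1.
Proof.
by move=> mX X0 s0; rewrite -(mgf0 X) mgf_le// => w; rewrite mulr0 mulr_ge0_le0.
Qed.

Lemma mgf_ltr X s t : measurable_fun setT X -> (forall w, 0 <= X w)%R ->
  0 < P [set w | (0 < X w)%R] -> (s < t)%R -> 'M_P X s < +oo ->
  'M_P X s < 'M_P X t.
Proof.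
move=> mX X0 PX st Xs; apply: mgf_lt => // [w|].
  by rewrite ler_wpM2l// ltW.
rewrite (_ : [set w | _] = [set w | (0 < X w)%R])//.
apply/seteqP; split => w /=; last by move=> x0; rewrite ltr_pM2l.
by rewrite [(0 < X w)%R]lt_neqAle X0 andbT; apply: contraTN => /eqP <-; rewrite !mul0r ltxx.
Qed.

End mgf.

(** * Feasible exponents and the busy period decay rate *)

(** By induction [n <= f n]; needed for Bolzano-Weierstrass subsequences. *)
Lemma increasing_seq_cvgn (f : nat -> nat) : increasing_seq f ->
  f n @[n --> \oo] --> \oo.
Proof.
move=> incf U [N _ NU]; exists N => // n /= Nn; apply: NU => /=.
apply: (leq_trans Nn) => {Nn}; elim: n => // n ih.
apply: (leq_ltn_trans ih); rewrite ltnNge.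
by have := incf n.+1 n; rewrite leEnat ltnn => ->.
Qed.

Section feasible.
Context {d} {T : measurableType d} {R : realType} (P : probability T R).
Variable A : T -> R.
Hypotheses (mA : measurable_fun [set: T] A) (A0 : forall w, (0 <= A w)%R).
Hypothesis PA : 0 < P [set w | (0 < A w)%R].
Implicit Types (X Y : T -> R) (r s t u : R).

(** With r = s + t, the equation Phi_A(t) = 1 / Phi_X(s) behind the busy period rate is relaxed to
    an inequality, which is monotone and stable under limits. For r = 0 it is the condition defining
    the workload rate. *)
Definition feasible X r s := (0 <= s)%R /\ 'M_P A (r - s)%R * 'M_P X s <= 1.

Lemma interarrival_mgf_fin u : (u <= 0)%R -> 'M_P A u \is a fin_num.
Proof.
by move=> u0; rewrite ge0_fin_numE ?mgf_ge0// (le_lt_trans (mgf_le1 _ _ _ _ _ _))// ltry.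
Qed.

Lemma fine_interarrival_mgf_gt0 u : (u <= 0)%R -> (0 < fine ('M_P A u))%R.
Proof. by move=> u0; rewrite fine_gt0// mgf_gt0//= -ge0_fin_numE ?mgf_ge0// interarrival_mgf_fin. Qed.

(** For u <= 0 the transform of [A] is a positive real and can be divided out, leaving a real upper
    bound on the transform of [X] alone. *)
Lemma mul_mgf_le1E X u s : (u <= 0)%R ->
  ('M_P A u * 'M_P X s <= 1) = ('M_P X s <= ((fine ('M_P A u))^-1)%:E).
Proof.
move=> u0; rewrite -{1}(fineK (interarrival_mgf_fin _ u0)).
by rewrite -lee_pdivlMl ?fine_interarrival_mgf_gt0// mule1.
Qed.

(** Sequential continuity on the nonpositive half-line: there e^{uA} is dominated by 1. *)
Lemma interarrival_mgf_cvg (u_ : R^nat) u : (forall n, u_ n <= 0)%R ->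
  (u_ n @[n --> \oo] --> u)%R -> (fine ('M_P A (u_ n)) @[n --> \oo] --> fine ('M_P A u))%R.
Proof.
move=> u0 cu.
have u0' : (u <= 0)%R by apply: (cvgr_to_le cu); apply: nearW.
apply: fine_cvg; rewrite fineK ?interarrival_mgf_fin//.
apply: (mgf_cvg P (fun=> A) A u_ u 0) => //.
- by apply: aeW => w; apply: cvgMr.
- by move=> n w; rewrite mulr_ge0_le0.
Qed.

Section fixed_service.
Variable X : T -> R.
Hypotheses (mX : measurable_fun [set: T] X) (X0 : forall w, (0 <= X w)%R).

(** If r > s, strict monotonicity gives Phi_A(r - s) > 1, while Phi_X(s) >= 1. *)
Lemma feasible_le r s : feasible X r s -> (r <= s)%R.
Proof.
move=> [s0 h]; rewrite -subr_le0 leNgt; apply/negP => u0.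
have : 'M_P A (r - s)%R <= 1.
  by apply: le_trans h; rewrite lee_pemulr ?mgf_ge0// mgf_ge1.
rewrite leNgt -(mgf0 P A) mgf_ltr// mgf0 ltry//.
Qed.

Lemma feasible_lt r s : (0 < P [set w | (0 < X w)%R]) -> (0 < s)%R ->
  feasible X r s -> (r < s)%R.
Proof.
move=> PX s0 h; have := feasible_le _ _ h; rewrite le_eqVlt => /orP[/eqP rs|//].
move: h => [_]; rewrite rs subrr mgf0 mul1e leNgt -(mgf0 P X) mgf_ltr// mgf0 ltry//.
Qed.

Lemma feasible_fin r s : feasible X r s -> 'M_P X s \is a fin_num.
Proof.
move=> h; have rs := feasible_le _ _ h; move: h => [s0].
rewrite mul_mgf_le1E ?subr_le0// => h.
by rewrite ge0_fin_numE ?mgf_ge0// (le_lt_trans h)// ltry.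
Qed.

Lemma feasible00 : feasible X 0 0.
Proof. by split => //; rewrite subrr !mgf0 mul1e. Qed.

Lemma feasible_mono Y r r' s : measurable_fun setT Y ->
  (forall w, Y w <= X w)%R -> (r' <= r)%R -> feasible X r s -> feasible Y r' s.
Proof.
move=> mY YX rr [s0 h]; split => //; apply: le_trans h.
apply: lee_pmul; rewrite ?mgf_ge0// mgf_le// => w.
  by rewrite ler_wpM2l// lerB.
by rewrite ler_wpM2r.
Qed.

End fixed_service.

(** The witnesses lie in the compact interval [0, S]. Along a convergent subsequence the inequality
    survives, by Fatou for the service factor and by continuity for the inter-arrival factor. *)
Lemma feasible_limit (X_ : (T -> R)^nat) X (r_ : R^nat) r (S : R) :
  (forall n, measurable_fun setT (X_ n)) -> measurable_fun setT X ->
  (forall n w, 0 <= X_ n w)%R ->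
  (forall w, X_ n w @[n --> \oo] --> X w)%R -> (r_ n @[n --> \oo] --> r)%R ->
  (forall n, exists s, (s <= S)%R /\ feasible (X_ n) (r_ n) s) ->
  exists s, feasible X r s.
Proof.
move=> mX_ mX X0 cX cr /choice[s_ hs].
have [|f incf /cvg_ex[/= s cs]] := @bolzano_weierstrass R s_.
  exists S; split; first exact: num_real.
  move=> x Sx n _ /=; have [sS [s0 _]] := hs n.
  by rewrite ger0_norm// (le_trans sS)// ltW.
have cf := increasing_seq_cvgn f incf.
have {}cs : (s_ (f n) @[n --> \oo] --> s)%R by [].
have {}cr : (r_ (f n) @[n --> \oo] --> r)%R by exact: (cvg_comp f r_ cf cr).
have {}cX w : (X_ (f n) w @[n --> \oo] --> X w)%R.
  exact: (cvg_comp f (X_ ^~ w) cf (cX w)).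
have s0 : (0 <= s)%R.
  by apply: (cvgr_to_ge cs); apply: nearW => n; have [_ []] := hs (f n).
have rs n : (r_ (f n) - s_ (f n) <= 0)%R.
  by rewrite subr_le0; apply: (feasible_le (X_ (f n))) => //; have [] := hs (f n).
have crs : (r_ (f n) - s_ (f n) @[n --> \oo] --> r - s)%R by exact: cvgB.
have rs0 : (r - s <= 0)%R by apply: (cvgr_to_le crs); apply: nearW.
exists s; split => //; rewrite mul_mgf_le1E//.
apply: (mgf_fatou P (X_ \o f) X (s_ \o f) s
  (fun n => (fine ('M_P A (r_ (f n) - s_ (f n))%R))^-1)%R).
- by move=> n; exact: mX_.
- exact: mX.
- by move=> w /=; apply: cvgM.
- by move=> n /=; rewrite -mul_mgf_le1E//; have [_ []] := hs (f n).
- apply: cvgV; last exact: interarrival_mgf_cvg.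
  by rewrite gt_eqF// fine_interarrival_mgf_gt0.
Qed.

(** Restricting the expectations to A <= q and to X >= q' bounds the product of the transforms below
    by a multiple of e^{s(q' - q)}. This uses only r >= 0 and Y >= X, so one bound serves all such
    [r] and [Y]. *)
Lemma feasible_bounded X (q q' : R) : (q < q')%R ->
  0 < P [set w | (A w <= q)%R] -> 0 < P [set w | (q' <= X w)%R] ->
  measurable_fun setT X ->
  exists S : R, forall Y r s, measurable_fun setT Y ->
    (forall w, X w <= Y w)%R -> (forall w, 0 <= Y w)%R ->
    (0 <= r)%R -> feasible Y r s -> (s <= S)%R.
Proof.
move=> qq' Pq Pq' mX.
have mE : measurable [set w | (A w <= q)%R].
  by rewrite -[X in measurable X]setTI; apply: measurable_fun_ler.
have mF : measurable [set w | (q' <= X w)%R].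
  by rewrite -[X in measurable X]setTI; apply: measurable_fun_ler.
pose a := fine (P [set w | (A w <= q)%R]).
pose b := fine (P [set w | (q' <= X w)%R]).
have aE : P [set w | (A w <= q)%R] = a%:E by rewrite fineK// fin_num_measure.
have bE : P [set w | (q' <= X w)%R] = b%:E by rewrite fineK// fin_num_measure.
have a0 : (0 < a)%R by rewrite -lte_fin -aE.
have b0 : (0 < b)%R by rewrite -lte_fin -bE.
have q0 : (0 <= q)%R.
  rewrite leNgt; apply/negP => q0; move: Pq; rewrite (_ : [set w | _] = set0).
    by rewrite measure0 ltxx.
  by apply/seteqP; split => w //= /le_lt_trans/(_ q0); rewrite ltNge A0.
(* Solves a b e^{s(q' - q)} <= 1 for s. *)
exists (- ln (a * b) / (q' - q))%R => Y r s mY XY Y0 r0 h.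
have rs := feasible_le _ mY Y0 _ _ h; move: h => [s0 h].
have hA : (expR (- (s * q)) * a)%:E <= 'M_P A (r - s)%R.
  apply: le_trans (mgf_markov P A (r - s) (- (s * q)) mA).
  rewrite EFinM lee_pmul2l ?lte_fin ?expR_gt0// -aE le_measure ?inE//.
    by rewrite -[X in measurable X]setTI; apply: measurable_fun_ler => //;
      exact: measurable_funM.
  move=> w /= Aq; have := A0 w; nra.
have hY : (expR (s * q') * b)%:E <= 'M_P Y s.
  apply: le_trans (mgf_markov P Y s (s * q') mY).
  rewrite EFinM lee_pmul2l ?lte_fin ?expR_gt0// -bE le_measure ?inE//.
    by rewrite -[X in measurable X]setTI; apply: measurable_fun_ler => //;
      exact: measurable_funM.
  move=> w /= Xq; have := XY w; nra.
have := le_trans (lee_pmul _ _ hA hY) h.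
rewrite -EFinM lee_fin.
rewrite !lee_fin !mulr_ge0 ?expR_ge0 ?(ltW a0) ?(ltW b0)// => /(_ isT isT).
rewrite mulrACA -expRD => {}h.
rewrite ler_pdivlMr ?subr_gt0//.
have : (expR (- (s * q) + s * q') <= (a * b)^-1)%R.
  by rewrite -ler_pdivlMr ?mulr_gt0// mul1r in h *.
rewrite -[leRHS]lnK ?posrE ?invr_gt0 ?mulr_gt0// ler_expR lnV ?posrE ?mulr_gt0//.
by apply: le_trans; rewrite mulrBr addrC.
Qed.

(** A value t of the inverse yields the feasible pair (s + t, s). Conversely, for a feasible pair 1
    / Phi_X(s) lies between Phi_A(r - s) and Phi_A(0) = 1, so the intermediate value theorem gives t
    in [r - s, 0] attaining it, and r <= s + t. *)
Lemma busy_decayE X : measurable_fun setT X -> (forall w, 0 <= X w)%R ->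
  busy_decay P A X = ereal_sup [set r%:E | r in [set r | exists s, feasible X r s]].
Proof.
move=> mX X0; apply/eqP; rewrite eq_le; apply/andP; split.
  apply: ge_ereal_sup => _ [s /= s0 <-].
  (* If the transform is infinite, its reciprocal 0 is not a value of Phi_A, so the inverse is the
     supremum of the empty set. *)
  have [Xoo|Xoo] := eqVneq ('M_P X s) +oo.
    rewrite Xoo invey /mgf_inv (_ : [set t | _] = set0) ?image_set0 ?ereal_sup0 ?leNye//.
    by apply/seteqP; split => // t /= h; have := mgf_gt0 P A t mA; rewrite h ltxx.
  have Xf : 'M_P X s \is a fin_num by rewrite ge0_fin_numE ?mgf_ge0// lt_neqAle Xoo leey.
  rewrite -leeBrDl//; apply: ge_ereal_sup => _ [t tE <-].
  rewrite leeBrDl//; apply: ereal_sup_ubound; exists (s + t)%R => //=.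
  exists s; split => //; rewrite (addrC s) addrK tE.
  rewrite -(fineK Xf) inver.
  have c0 : (0 < fine ('M_P X s))%R by rewrite -lte_fin (fineK Xf) mgf_gt0.
  by rewrite gt_eqF// -EFinM mulVf ?gt_eqF.
apply: ge_ereal_sup => _ [r /= [s h] <-].
have rs := feasible_le _ mX X0 _ _ h; have Xf := feasible_fin _ mX X0 _ _ h.
have [s0] := h; rewrite mul_mgf_le1E ?subr_le0// => {}h.
pose c := fine ('M_P X s).
have c0 : (0 < c)%R by rewrite -lte_fin (fineK Xf) mgf_gt0.
have c1 : (1 <= c)%R by rewrite -lee_fin (fineK Xf) mgf_ge1.
(* An even extension of Phi_A from the nonpositive half-line, continuous on the whole line. *)
pose phi (u : R) := fine ('M_P A (- `|u|)%R).
have phiE u : (u <= 0)%R -> phi u = fine ('M_P A u).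
  by move=> u0; rewrite /phi ler0_norm// opprK.
have cphi : continuous phi.
  move=> u; apply/(@cvg_nbhsP _ R^o) => u_ cu; apply: interarrival_mgf_cvg => [n|].
    by rewrite oppr_le0.
  by apply: cvgN; apply: cvg_norm.
have [||t tI tE] := @IVT _ phi (r - s) 0 c^-1 _ (continuous_subspaceT cphi).
- by rewrite subr_le0.
- rewrite !phiE ?subr_le0// mgf0 /=.
  rewrite ge_min le_max [(c^-1 <= 1)%R]invf_le1// c1 orbT andbT; apply/orP; left.
  rewrite -[leLHS]invrK lef_pV2 ?posrE// ?invr_gt0 ?fine_interarrival_mgf_gt0 ?subr_le0//.
  by rewrite -lee_fin /c fineK.
move: tI; rewrite in_itv/= => /andP[rst t0].
have {}tE : 'M_P A t = ('M_P X s)^-1.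
  move: tE; rewrite phiE// => tE.
  by rewrite -(fineK (interarrival_mgf_fin _ t0)) tE -(fineK Xf) inver gt_eqF.
apply: le_ereal_sup_tmp; exists (s%:E + mgf_inv P A ('M_P X s)^-1); first by exists s.
apply: (@le_trans _ _ (s%:E + t%:E)).
  by rewrite -EFinD lee_fin -lerBlDl.
by rewrite leeD2l//; apply: ereal_sup_ubound; exists t.
Qed.

End feasible.

(** * Queues that can build up work *)

Section preliminaries.
Context {d} {T : measurableType d} {R : realType} (P : probability T R).
Implicit Types (X Y : T -> R) (y s t : R).

(** A countable union of null sets is null; this extracts a single level from a strict inequality
    holding with positive probability. *)
Lemma bigcup_prob_gt0 (F : (set T)^nat) (E : set T) :
  (forall n, measurable (F n)) -> E `<=` \bigcup_n F n -> 0 < P E -> measurable E ->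
  exists n, 0 < P (F n).
Proof.
move=> mF EF PE mE; apply: contrapT => /forallNP h.
have : P.-negligible (\bigcup_n F n).
  apply: negligible_bigcup => k; apply/negligibleP => //.
  by apply/eqP; rewrite -measure_le0 leNgt; apply/negP; exact: h.
move=> /(negligibleS EF) /(measure_negligible mE) PE0.
by rewrite PE0 ltxx in PE.
Qed.

Lemma measurable_ler X (q : R) : measurable_fun setT X ->
  measurable [set w | (X w <= q)%R].
Proof. by move=> mX; rewrite -[X in measurable X]setTI; apply: measurable_fun_ler. Qed.

Lemma measurable_ger X (q : R) : measurable_fun setT X ->
  measurable [set w | (q <= X w)%R].
Proof. by move=> mX; rewrite -[X in measurable X]setTI; apply: measurable_fun_ler. Qed.

Lemma measurable_ltr X (q : R) : measurable_fun setT X ->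
  measurable [set w | (X w < q)%R].
Proof. by move=> mX; rewrite -[X in measurable X]setTI; apply: measurable_fun_ltr. Qed.

Lemma measurable_gtr X (q : R) : measurable_fun setT X ->
  measurable [set w | (q < X w)%R].
Proof. by move=> mX; rewrite -[X in measurable X]setTI; apply: measurable_fun_ltr. Qed.

Lemma measurable_eqr X (q : R) : measurable_fun setT X ->
  measurable [set w | X w = q].
Proof.
move=> mX; rewrite (_ : [set w | _] = [set w | (X w <= q)%R] `&` [set w | (q <= X w)%R]).
  by apply: measurableI; [exact: measurable_ler|exact: measurable_ger].
apply/seteqP; split => w /=; first by move=> ->.
by move=> [? ?]; apply/eqP; rewrite eq_le; apply/andP.
Qed.

Lemma ae_mgf_le X Y s t : measurable_fun setT X -> measurable_fun setT Y ->
  {ae P, forall w, X w * s <= Y w * t}%R -> 'M_P X s <= 'M_P Y t.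
Proof.
move=> mX mY XY; rewrite !mgfE; apply: ae_ge0_le_integral => //.
- exact: measurable_exp_mul.
- exact: measurable_exp_mul.
- by apply: filterS XY => w XYw _; rewrite lee_fin ler_expR.
Qed.

Lemma mgf_cst (c s : R) : 'M_P (fun=> c) s = (expR (c * s))%:E.
Proof. by rewrite mgfE integral_cst// [X in _ * X]probability_setT mule1. Qed.

Lemma truncatedE (B : T -> R) y w :
  truncated B y w = if (B w < y)%R then B w else 0%R.
Proof.
rewrite /truncated indicE; have [h|h] := ltP (B w) y.
  by rewrite mem_set ?mulr1.
by rewrite memNset ?mulr0//=; apply/negP; rewrite -leNgt.
Qed.

Lemma measurable_truncated (B : T -> R) y : measurable_fun setT B ->
  measurable_fun setT (truncated B y).
Proof.
by move=> mB; apply: measurable_funM => //; apply: measurable_indic; exact: measurable_ltr.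
Qed.

Lemma truncated_ge0 (B : T -> R) y w : (0 <= B w)%R -> (0 <= truncated B y w)%R.
Proof. by move=> B0; rewrite truncatedE; case: ifP. Qed.

Lemma truncated_le_id (B : T -> R) y w : (0 <= B w)%R -> (truncated B y w <= B w)%R.
Proof. by move=> B0; rewrite truncatedE; case: ifP. Qed.

Lemma truncated_le (B : T -> R) y y' w : (0 <= B w)%R -> (y <= y')%R ->
  (truncated B y w <= truncated B y' w)%R.
Proof.
move=> B0 yy'; rewrite !truncatedE; case: ifPn => [By|_]; last by case: ifP.
by rewrite (lt_le_trans By).
Qed.

Lemma truncated_bound (B : T -> R) y w : (0 <= y)%R -> (truncated B y w <= y)%R.
Proof. by move=> y0; rewrite truncatedE; case: ifPn => // /ltW. Qed.

(** Because the truncation keeps values strictly below the level, convergence from the left holds at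
    every point, by eventual constancy. *)
Lemma truncated_cvg_left (B : T -> R) (y_ : R^nat) y w :
  (forall n, y_ n <= y)%R -> (y_ n @[n --> \oo] --> y)%R ->
  (truncated B (y_ n) w @[n --> \oo] --> truncated B y w)%R.
Proof.
move=> yy cy; apply: cvg_near_cst.
have [By|yB] := ltP (B w) y.
  near=> n; have Bn : (B w < y_ n)%R by near: n; exact: cvgr_gt By.
  by rewrite !truncatedE By Bn.
apply: nearW => n; rewrite !truncatedE !ifF//; apply/negbTE; rewrite -leNgt//.
exact: le_trans yB.
Unshelve. all: by end_near. Qed.

(** At a point where [B] equals [y] the truncation at [y] is 0 but is [y] at any larger level; such
    points are excluded. *)
Lemma truncated_cvg_right (B : T -> R) (y_ : R^nat) y w :
  (forall n, y <= y_ n)%R -> (y_ n @[n --> \oo] --> y)%R -> B w <> y ->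
  (truncated B (y_ n) w @[n --> \oo] --> truncated B y w)%R.
Proof.
move=> yy cy /eqP Bwy; apply: cvg_near_cst.
have [By|yB] := ltP (B w) y.
  apply: nearW => n; rewrite !truncatedE By (lt_le_trans By)//.
have {}yB : (y < B w)%R by rewrite lt_neqAle eq_sym Bwy.
near=> n; have Bn : (y_ n < B w)%R by near: n; exact: cvgr_lt yB.
rewrite !truncatedE !ifF//; apply/negbTE; rewrite -leNgt ltW//.
Unshelve. all: by end_near. Qed.

Lemma truncated_cvg_pinfty (B : T -> R) (y_ : R^nat) w :
  (forall n, n%:R <= y_ n)%R -> (truncated B (y_ n) w @[n --> \oo] --> B w)%R.
Proof.
move=> ny; apply: cvg_near_cst; near=> n; rewrite truncatedE ifT//.
have : (B w < n%:R)%R by near: n; exact: nbhs_infty_gtr.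
by move/lt_le_trans; apply.
Unshelve. all: by end_near. Qed.

(** The sequence starts at a + b and moves monotonically to a, so both ends can be prescribed. *)
Lemma cvg_harmonic_comb (a b : R) :
  (a + b * n.+1%:R^-1 @[n --> \oo] --> a)%R.
Proof.
have : (b * n.+1%:R^-1 @[n --> \oo] --> b * 0)%R.
  by apply: cvgMr; exact: cvg_harmonic.
by rewrite mulr0 => /(cvgD (cvg_cst a)); rewrite addr0.
Qed.

Lemma harmonic_itv n : (0 < (n.+1%:R^-1 : R) <= 1)%R.
Proof. by rewrite invr_gt0 ltr0n/= invf_le1// ler1n. Qed.

End preliminaries.

(** * Backloggable service times and attainment of the busy period rate *)

Section backloggable.
Context {d} {T : measurableType d} {R : realType} (P : probability T R).
Variable A : T -> R.
Hypotheses (mA : measurable_fun [set: T] A) (A0 : forall w, (0 <= A w)%R).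
Hypothesis PA : 0 < P [set w | (0 < A w)%R].
Implicit Types (X Y : T -> R) (r s t u : R).

(* For independent A and X this says exactly that P(A < X) > 0. *)
Definition backloggable X := exists q q' : R, [/\ (q < q')%R,
  0 < P [set w | (A w <= q)%R] & 0 < P [set w | (q' <= X w)%R]].

(** Two rationals fit between [A w] and [X w], and there are countably many pairs. *)
Lemma backloggable_of_lt X : measurable_fun setT X ->
  0 < P [set w | (A w < X w)%R] -> backloggable X.
Proof.
move=> mX PAX.
(* Enumerates the pairs of rationals; codes of no increasing pair get the empty set. *)
pose F n := if @unpickle (rat * rat)%type n is Some q then
  if (q.1 < q.2)%R then [set w | (A w <= ratr q.1)%R] `&` [set w | (ratr q.2 <= X w)%R]
  else set0 else set0.
have mE : measurable [set w | (A w < X w)%R].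
  by rewrite -[X in measurable X]setTI; apply: measurable_fun_ltr.
have [|w /= AX|//|//|n] := bigcup_prob_gt0 P F [set w | (A w < X w)%R].
- move=> n; rewrite /F; case: unpickle => // -[q q']; case: ifP => // _.
  by apply: measurableI; [exact: measurable_ler|exact: measurable_ger].
- have [q] := rat_in_itvoo AX; rewrite in_itv/= => /andP[Aq qX].
  have [q'] := rat_in_itvoo qX; rewrite in_itv/= ltr_rat => /andP[qq' q'X].
  exists (pickle (q, q')); first by [].
  have -> : F (pickle (q, q')) =
      [set w | (A w <= ratr q)%R] `&` [set w | (ratr q' <= X w)%R].
    by rewrite /F pickleK [(_.1 < _.2)%R]qq'.
  by split; exact: ltW.
rewrite /F; case: unpickle => [[q q'] /=|]; last by rewrite measure0 ltxx.
case: ifPn => [qq'|]; last by rewrite measure0 ltxx.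
move=> PF; exists (ratr q), (ratr q'); rewrite ltr_rat; split => //.
- apply: (lt_le_trans PF); apply: le_measure; rewrite ?inE//.
  + by apply: measurableI; [exact: measurable_ler|exact: measurable_ger].
  + exact: measurable_ler.
- apply: (lt_le_trans PF); apply: le_measure; rewrite ?inE//.
  + by apply: measurableI; [exact: measurable_ler|exact: measurable_ger].
  + exact: measurable_ger.
Qed.

Lemma backloggable_mono X Y : measurable_fun setT X -> measurable_fun setT Y ->
  (forall w, X w <= Y w)%R -> backloggable X -> backloggable Y.
Proof.
move=> mX mY XY [q [q' [qq' Pq Pq']]]; exists q, q'; split => //.
apply: (lt_le_trans Pq'); apply: le_measure; rewrite ?inE//.
- exact: measurable_ger.
- exact: measurable_ger.
- by move=> w /= /le_trans; apply.
Qed.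

Lemma backloggable_level X : backloggable X -> exists q q' : R, [/\ (0 <= q)%R, (q < q')%R,
  0 < P [set w | (A w <= q)%R] & 0 < P [set w | (q' <= X w)%R]].
Proof.
move=> [q [q' [qq' Pq Pq']]]; exists q, q'; split => //.
rewrite leNgt; apply/negP => q0; move: Pq; rewrite (_ : [set w | _] = set0).
  by rewrite measure0 ltxx.
by apply/seteqP; split => w //= /le_lt_trans/(_ q0); rewrite ltNge A0.
Qed.

Lemma backloggable_pos X : measurable_fun setT X -> backloggable X ->
  0 < P [set w | (0 < X w)%R].
Proof.
move=> mX /backloggable_level[q [q' [q0 qq' _ Pq']]].
apply: (lt_le_trans Pq'); apply: le_measure; rewrite ?inE//.
- exact: measurable_ger.
- exact: measurable_gtr.
- by move=> w /= /(lt_le_trans qq'); exact: le_lt_trans.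
Qed.

(** Bounded witnesses bound the feasible [r] as well, since r <= s; the supremum is then a limit of
    feasible values with witnesses in a compact interval. *)
Lemma busy_decay_attained X : measurable_fun setT X -> (forall w, 0 <= X w)%R ->
  backloggable X ->
  exists r s, [/\ (0 <= r)%R, busy_decay P A X = r%:E & feasible P A X r s].
Proof.
move=> mX X0 [q [q' [qq' Pq Pq']]].
have [S hS] := feasible_bounded P A mA A0 PA X q q' qq' Pq Pq' mX.
pose E := [set r | exists s, feasible P A X r s].
have E0 : E 0%R by exists 0%R; exact: feasible00.
(* [S] bounds the witnesses only for r >= 0; the maximum with 0 covers negative [r]. *)
have Eub : ubound E (Num.max S 0%R).
  move=> r [s h]; have [r0|r0] := leP 0%R r; last by rewrite le_max (ltW r0) orbT.
  rewrite le_max (le_trans (feasible_le P A mA A0 PA X mX X0 r s h))//.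
  exact: (hS X r s).
have supE : has_sup E by split; [exists 0%R|exists (Num.max S 0%R)].
have r0 : (0 <= sup E)%R by apply: sup_ubound => //; exact: supE.2.
rewrite busy_decayE//.
have -> : ereal_sup [set r%:E | r in [set r | exists s, feasible P A X r s]] = (sup E)%:E.
  by rewrite ereal_sup_EFin//; [exact: supE.2|exact: supE.1].
have [|||||s hs] := feasible_limit P A mA A0 PA (fun=> X) X
    (fun n => sup E + (- sup E) * n.+1%:R^-1)%R (sup E) S _ mX.
- by [].
- by [].
- by move=> w; exact: cvg_cst.
- exact: cvg_harmonic_comb.
(* [rn] is sup E (1 - 1/(n + 1)): nonnegative, and strictly below the supremum unless that is 0, so
   it is feasible by downward closure. *)
- move=> n; set rn := (_ + _)%R.
  have rn0 : (0 <= rn)%R.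
    have /andP[] := harmonic_itv (R := R) n; rewrite /rn; set k := (_^-1)%R => k0 k1; nra.
  have [s hs] : E rn.
    have [e0|e0] := eqVneq (sup E) 0%R.
      by rewrite /rn e0 oppr0 mul0r addr0.
    have [|r Er rnr] := @sup_adherent _ E (sup E * n.+1%:R^-1)%R _ supE.
      by rewrite mulr_gt0// lt_neqAle eq_sym e0.
    have [s h] := Er; exists s.
    apply: (feasible_mono P A mA A0 X mX X r rn s) => //.
    by apply: ltW; apply: le_lt_trans rnr; rewrite /rn mulNr.
  by exists s; split => //; exact: (hS X rn s).
by exists (sup E), s.
Qed.

Lemma mul_mgf_lt1E X u s : (u <= 0)%R ->
  ('M_P A u * 'M_P X s < 1) = ('M_P X s < ((fine ('M_P A u))^-1)%:E).
Proof.
move=> u0; rewrite -{1}(fineK (interarrival_mgf_fin P A mA A0 u u0)).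
by rewrite -lte_pdivlMl ?fine_interarrival_mgf_gt0// mule1.
Qed.

(** Phi_A is strictly increasing and Phi_X(s) is finite and positive, so lowering r' creates
    slack. *)
Lemma feasible_strict X r r' s : measurable_fun setT X -> (forall w, 0 <= X w)%R ->
  (r < r')%R -> feasible P A X r' s -> 'M_P A (r - s)%R * 'M_P X s < 1.
Proof.
move=> mX X0 rr' h; have r's := feasible_le P A mA A0 PA X mX X0 _ _ h.
have Xf := feasible_fin P A mA A0 PA X mX X0 _ _ h.
apply: lt_le_trans h.2; rewrite lte_pmul2r//.
  by rewrite mgf_ltr// ?ltrB2r// ?ltrD2r// ltey_eq interarrival_mgf_fin// subr_le0 ltW// (lt_le_trans rr').
by rewrite mgf_gt0.
Qed.

Lemma feasible_improve X r s : measurable_fun setT X -> (forall w, 0 <= X w)%R ->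
  (0 <= s)%R -> (r < s)%R -> 'M_P A (r - s)%R * 'M_P X s < 1 ->
  exists2 r', (r < r')%R & feasible P A X r' s.
Proof.
move=> mX X0 s0 rs h.
have Xf : 'M_P X s \is a fin_num.
  rewrite ge0_fin_numE ?mgf_ge0//; move: h; rewrite mul_mgf_lt1E ?subr_le0 ?(ltW rs)//.
  by move/lt_trans; apply; exact: ltry.
(* Decreases from 0 to r - s, hence stays where Phi_A is continuous; r' will be s + [u_ N], which
   exceeds r. *)
pose u_ n := (r - s + (s - r) * n.+1%:R^-1)%R.
have u_le0 n : (u_ n <= 0)%R.
  have /andP[] := harmonic_itv (R := R) n; rewrite /u_; set k := (_^-1)%R => k0 k1; nra.
have cu := interarrival_mgf_cvg P A mA A0 u_ _ u_le0 (cvg_harmonic_comb (r - s) (s - r)).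
have c0 : (0 < fine ('M_P X s))%R by rewrite -lte_fin fineK// mgf_gt0.
have lt1 : (fine ('M_P A (r - s)) < (fine ('M_P X s))^-1)%R.
  have uf : 'M_P A (r - s)%R \is a fin_num.
    by rewrite interarrival_mgf_fin// subr_le0 ltW.
  by rewrite -lte_fin -[ltRHS]mule1 lte_pdivlMl// (fineK Xf) (fineK uf) muleC.
have [N _ hN] := cvgr_lt _ cu _ lt1.
have {hN} := hN N (leqnn N) => /= hN.
exists (s + u_ N)%R.
  have /andP[] := harmonic_itv (R := R) N; rewrite /u_; set k := (_^-1)%R => k0 k1; nra.
split => //; rewrite (addrC s) addrK -(fineK (interarrival_mgf_fin P A mA A0 _ (u_le0 N))).
by rewrite -(fineK Xf) -EFinM lee_fin -ler_pdivlMr// mul1r ltW.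
Qed.

End backloggable.

(** * Truncated service times *)

Section truncation.
Context {d} {T : measurableType d} {R : realType} (P : probability T R).
Variable A : T -> R.
Hypotheses (mA : measurable_fun [set: T] A) (A0 : forall w, (0 <= A w)%R).
Hypothesis PA : 0 < P [set w | (0 < A w)%R].
Implicit Types (X : T -> R) (y r s : R).

(** With b the essential supremum of [X], almost surely X <= b <= A. For s = r + n the inter-arrival
    factor is at most e^{-bn}, and e^{-bn} Phi_X(r + n) tends to 0 when b > 0, since then X < b
    almost surely. *)
Lemma not_backloggable_feasible X (y : R) r : measurable_fun setT X ->
  (forall w, 0 <= X w <= y)%R ->
  (forall b : R, (0 < b)%R -> P [set w | X w = b] = 0) ->
  ~ backloggable P A X -> (0 <= r)%R -> exists s, feasible P A X r s.
Proof.
move=> mX Xy Xna nsep r0.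
pose E := [set q : R | 0 < P [set w | (q <= X w)%R]].
have E0 : E 0%R.
  rewrite /E /= (_ : [set w | _] = setT) ?probability_setT ?lte01//.
  by apply/seteqP; split => w //= _; have /andP[] := Xy w.
have Eub : ubound E y.
  move=> q /=; rewrite leNgt => Pq; apply/negP => yq; move: Pq.
  rewrite /E /= (_ : [set w | _] = set0) ?measure0 ?ltxx//.
  apply/seteqP; split => w //= qX; have /andP[_ Xyw] := Xy w.
  by have := lt_le_trans yq (le_trans qX Xyw); rewrite ltxx.
have supE : has_sup E by split; [exists 0%R|exists y].
set b := sup E.
have b0 : (0 <= b)%R by apply: sup_ubound => //; exact: supE.2.
have Xb : {ae P, forall w, X w <= b}%R.
  exists [set w | (b < X w)%R]; split; first exact: measurable_gtr.
    apply/eqP; rewrite -measure_le0 leNgt; apply/negP => Pb.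
    have [|w /= bX||n] := bigcup_prob_gt0 P (fun n => [set w | (b + n.+1%:R^-1 <= X w)%R]) _ _ _ Pb.
    - by move=> n; exact: measurable_ger.
    - by have [k kX] := ltr_add_invr bX; exists k => //=; exact: ltW.
    - exact: measurable_gtr.
    - move=> En; have : (b + n.+1%:R^-1 <= b)%R by apply: sup_ubound => //; exact: supE.2.
      by rewrite gerDl leNgt invr_gt0 ltr0n.
  by move=> w /= /negP; rewrite -ltNge.
(* Otherwise A <= b - 1/(n + 1) has positive probability for some n, and a level of [E] above that
   number would make [X] backloggable. *)
have bA : {ae P, forall w, b <= A w}%R.
  exists [set w | (A w < b)%R]; split; first exact: measurable_ltr.
    apply/eqP; rewrite -measure_le0 leNgt; apply/negP => Pb.
    have [|w /= bX||n] := bigcup_prob_gt0 P (fun n => [set w | (A w <= b - n.+1%:R^-1)%R]) _ _ _ Pb.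
    - by move=> n; exact: measurable_ler.
    - have [k kX] := ltr_add_invr bX; exists k => //=.
      by rewrite lerBrDr; exact: ltW.
    - exact: measurable_ltr.
    - move=> An; have [|q Eq bq] := @sup_adherent _ E n.+1%:R^-1 _ supE.
        by rewrite invr_gt0 ltr0n.
      by apply: nsep; exists (b - n.+1%:R^-1)%R, q.
  by move=> w /= /negP; rewrite -ltNge.
(* Truncation may create an atom at 0, so b = 0 is separate: then [X] vanishes almost surely and s =
   r works. *)
have [b_eq0|b_neq0] := eqVneq b 0%R.
  exists r; split => //; rewrite subrr mgf0 mul1e.
  rewrite (@le_trans _ _ ('M_P (fun=> b) r))//; last first.
    by rewrite mgf_cst b_eq0 mul0r expR0.
  by apply: ae_mgf_le => //; apply: filterS Xb => w Xw; rewrite ler_wpM2r.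
have {b_neq0}b_gt0 : (0 < b)%R by rewrite lt_neqAle eq_sym b_neq0.
(* Where X < b this is a geometric sequence of ratio e^{X - b} < 1; it is dominated by e^{br}. *)
pose f n w := expR (X w * (r + n%:R) - b * n%:R).
have mf n : measurable_fun setT (fun w => (f n w)%:E).
  apply/measurable_EFinP; apply: measurableT_comp => //.
  apply: measurable_funB => //; exact: measurable_funM.
have cf : \int[P]_w (f n w)%:E @[n --> \oo] --> 0.
  rewrite -(integral0 P setT).
  have [] := @dominated_convergence _ _ _ P setT measurableT (fun n w => (f n w)%:E)
    (cst 0) (cst (expR (b * r))%:E) mf (measurable_cst _).
  - have Xnb : {ae P, forall w, X w <> b}.
      exists [set w | X w = b]; split => //; last by move=> w /= /contrapT.
      + exact: measurable_eqr.
      + exact: Xna.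
    apply: filterS2 Xb Xnb => w Xw /eqP Xnw _.
    have Xltb : (X w < b)%R by rewrite lt_neqAle Xnw.
    apply: cvg_EFin; first exact: nearW.
    rewrite (_ : fine \o _ = geometric (expR (X w * r)) (expR (X w - b))).
      by apply: cvg_geometric; rewrite ger0_norm ?expR_ge0// expR_lt1 subr_lt0.
    apply/funext => n; rewrite /f /geometric /= -expRM_natl -expRD.
    by congr expR; ring.
  - exact: finite_measure_integrable_cst.
  - apply: filterS Xb => w Xw n _ /=.
    rewrite lee_fin ger0_norm ?expR_ge0// ler_expR.
    have : (0 <= n%:R :> R)%R by []. 
    nra.
  - by [].
have [N _ /(_ N (leqnn N)) /= hN] := cf _ (open_ereal_lt' lte01).
exists (r + N%:R)%R; split; first by rewrite addr_ge0.
have MA : 'M_P A (r - (r + N%:R)) <= (expR (- (b * N%:R)))%:E.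
  rewrite -mulrN -(mgf_cst P); apply: ae_mgf_le => //.
  apply: filterS bA => w bw.
  have : (0 <= N%:R :> R)%R by [].
  nra.
have MX : 'M_P X (r + N%:R) <= (expR (b * N%:R))%:E.
  have : (expR (b * N%:R))%:E * \int[P]_w (f N w)%:E <= (expR (b * N%:R))%:E.
    by rewrite -[leRHS]mule1 lee_pmul2l ?lte_fin ?expR_gt0// ltW.
  apply: le_trans; rewrite -ge0_integralZl//; last first.
    by move=> w _; rewrite lee_fin expR_ge0.
  rewrite mgfE le_eqVlt; apply/orP; left; apply/eqP; apply: eq_integral => w _.
  by rewrite -EFinM -expRD addrCA addrN addr0.
apply: (le_trans (lee_pmul (mgf_ge0 _ _ _) (mgf_ge0 _ _ _) MA MX)).
by rewrite -EFinM -expRD addNr expR0.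
Qed.

Variable B : T -> R.
Hypotheses (mB : measurable_fun [set: T] B) (B0 : forall w, (0 <= B w)%R).
Hypothesis B_diffuse : forall b : R, P [set w | B w = b] = 0.

Let mtr y : measurable_fun setT (truncated B y).
Proof. exact: measurable_truncated. Qed.

Let tr0 y w : (0 <= truncated B y w)%R.
Proof. exact: truncated_ge0. Qed.

Lemma not_backloggable_busy_decay y : (0 < y)%R -> ~ backloggable P A (truncated B y) ->
  busy_decay P A (truncated B y) = +oo.
Proof.
move=> y0 nsep; rewrite busy_decayE//; apply: hasNub_ereal_sup; last first.
  by exists 0%R; exists 0%R; exact: feasible00.
move=> [M hM]; have [|||||s hs] := not_backloggable_feasible (truncated B y) y (Num.max M 0 + 1)%R.
- exact: mtr.
- by move=> w; rewrite tr0 truncated_bound// ltW.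
(* A positive value of the truncation is a value of [B], so no positive atom appears. *)
- move=> b b0; apply/eqP; rewrite -measure_le0 -(B_diffuse b) le_measure ?inE//.
  + exact: measurable_eqr.
  + exact: measurable_eqr.
  + move=> w /=; rewrite truncatedE; case: ifP => // _ b0'.
    by rewrite -b0' ltxx in b0.
- by [].
- by rewrite addr_ge0// le_max lexx orbT.
have := hM (Num.max M 0 + 1)%R (ex_intro _ s hs).
by rewrite leNgt ltr_pwDr// le_max lexx.
Qed.

(** Levels decreasing to [y] give bounded truncations that converge almost surely, as [B] has no
    atom at [y]; a strict inequality therefore persists slightly to the right. *)
Lemma truncated_feasible_right y r s : (0 < y)%R -> (0 <= s)%R -> (r <= s)%R ->
  'M_P A (r - s)%R * 'M_P (truncated B y) s < 1 ->
  exists2 y', (y < y')%R & feasible P A (truncated B y') r s.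
Proof.
move=> y0 s0 rs; rewrite mul_mgf_lt1E ?subr_le0// => h.
have hy n : (y + 1 * n.+1%:R^-1 <= y + 1)%R.
  by rewrite lerD2l mul1r; have /andP[] := harmonic_itv (R := R) n.
have [||N _ /(_ N (leqnn N)) /= hN] := mgf_cvg P (fun n => truncated B (y + 1 * n.+1%:R^-1)%R) (truncated B y)
  (fun=> s) s ((y + 1) * s)%R (fun n => mtr _) (mtr _) _ _ _
  (open_ereal_lt' h).
- have nB : {ae P, forall w, B w <> y}.
    exists [set w | B w = y]; split => //; last by move=> w /= /contrapT.
    exact: measurable_eqr.
  apply: filterS nB => w Bw; apply: cvgMl; apply: truncated_cvg_right => //.
    by move=> n; rewrite lerDl mul1r; have /andP[/ltW] := harmonic_itv (R := R) n.
  exact: cvg_harmonic_comb.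
- move=> n w; rewrite ler_wpM2r// (le_trans _ (hy n))// truncated_bound//.
  by rewrite addr_ge0 ?(ltW y0)// mul1r; have /andP[/ltW] := harmonic_itv (R := R) n.
exists (y + 1 * N.+1%:R^-1)%R.
  by rewrite ltrDl mul1r; have /andP[] := harmonic_itv (R := R) N.
by split => //; rewrite mul_mgf_le1E ?subr_le0// ltW.
Qed.

(** As q' > 0, reaching level q' forces B < y, hence B < y - 1/(n + 1) for some n. *)
Lemma backloggable_truncated_left y : (0 < y)%R -> backloggable P A (truncated B y) ->
  exists2 y', (0 < y' < y)%R & backloggable P A (truncated B y').
Proof.
move=> y0 /(backloggable_level _ _ A0)[q [q' [q0 qq' Pq Pq']]].
have [|w /= qw||n Pn] := bigcup_prob_gt0 P
  (fun n => [set w | (q' <= truncated B (y - n.+1%:R^-1) w)%R]) _ _ _ Pq'.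
- by move=> n; exact: measurable_ger.
- have By : (B w < y)%R.
    rewrite ltNge; apply/negP => yB; move: qw; rewrite truncatedE ltNge yB/=.
    by rewrite leNgt (le_lt_trans q0).
  have [k kX] := ltr_add_invr By; exists k => //=.
  by move: qw; rewrite !truncatedE By ifT// ltrBrDr.
- exact: measurable_ger.
(* The maximum with y / 2 keeps the level positive. *)
exists (Num.max (y - n.+1%:R^-1) (y / 2))%R.
  rewrite lt_max gt_max divr_gt0// orbT ltr_pdivrMr// ltr_pMr// ltr1n andbT.
  by rewrite gtrBl invr_gt0 ltr0n.
apply: (@backloggable_mono _ _ _ P A (truncated B (y - n.+1%:R^-1)%R)) => //.
  by move=> w; apply: truncated_le => //; rewrite le_max lexx.
by exists q, q'.
Qed.

(** A backloggable level y' < y supplies one bound on the witnesses for all levels in [y', y), which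
    allows the passage to the limit. *)
Lemma truncated_feasible_left y r : (0 < y)%R -> (0 <= r)%R ->
  backloggable P A (truncated B y) ->
  (forall y', (0 < y' < y)%R -> exists s, feasible P A (truncated B y') r s) ->
  exists s, feasible P A (truncated B y) r s.
Proof.
move=> y0 r0 /(backloggable_truncated_left _ y0)[y' /andP[y'0 y'y] [q [q' [qq' Pq Pq']]]] h.
have [S hS] := feasible_bounded P A mA A0 PA (truncated B y') q q' qq' Pq Pq' (mtr _).
pose y_ n := (y + (y' - y) * n.+1%:R^-1)%R.
have y_itv n : (y' <= y_ n < y)%R.
  have /andP[] := harmonic_itv (R := R) n; rewrite /y_; set k := (_^-1)%R => k0 k1.
  by apply/andP; split; nra.
apply: (feasible_limit P A mA A0 PA (fun n => truncated B (y_ n)) _ (fun=> r) r S) => //.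
- move=> w; apply: truncated_cvg_left; last exact: cvg_harmonic_comb.
  by move=> n; have /andP[_ /ltW] := y_itv n.
- exact: cvg_cst.
- move=> n; have /andP[yn1 yn2] := y_itv n.
  have [|s hs] := h (y_ n); first by rewrite yn2 (lt_le_trans y'0).
  exists s; split => //; apply: (hS (truncated B (y_ n)) r s) => // w.
  exact: truncated_le.
Qed.

Lemma backloggable_truncated_pinfty : backloggable P A B ->
  exists n, backloggable P A (truncated B n.+1%:R).
Proof.
move=> /(backloggable_level _ _ A0)[q [q' [q0 qq' Pq Pq']]].
have [|w /= qw||n Pn] := bigcup_prob_gt0 P
  (fun n => [set w | (q' <= truncated B n.+1%:R w)%R]) _ _ _ Pq'.
- by move=> n; exact: measurable_ger.
- exists (Num.truncn (B w)) => //=; rewrite truncatedE ifT//.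
  exact: truncnS_gt.
- exact: measurable_ger.
by exists n, q, q'.
Qed.

Lemma truncated_feasible_pinfty r : (0 <= r)%R -> backloggable P A B ->
  (forall y, (0 < y)%R -> exists s, feasible P A (truncated B y) r s) ->
  exists s, feasible P A B r s.
Proof.
move=> r0 /backloggable_truncated_pinfty[N [q [q' [qq' Pq Pq']]]] h.
have [S hS] := feasible_bounded P A mA A0 PA _ q q' qq' Pq Pq' (mtr _).
(* The shift keeps every level at or above the backloggable one, where [S] applies. *)
apply: (feasible_limit P A mA A0 PA (fun n => truncated B (n + N.+1)%:R) _ (fun=> r) r S) => //.
- by move=> w; apply: truncated_cvg_pinfty => n; rewrite ler_nat leq_addr.
- exact: cvg_cst.
- move=> n; have [|s hs] := h (n + N.+1)%:R%R; first by rewrite ltr0n addnS.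
  exists s; split => //; apply: (hS (truncated B (n + N.+1)%:R) r s) => // w.
  by apply: truncated_le => //; rewrite ler_nat leq_addl.
Qed.

End truncation.

(** * The decay rate as a function of the truncation level *)

(** Convergence in the order topology, in a form that also covers infinite limits. *)
Lemma cvge_order {R : realType} {I : Type} (F : set_system I) {FF : Filter F}
    (f : I -> \bar R) (l : \bar R) :
  (forall c, c < l -> \forall x \near F, c < f x) ->
  (forall c, l < c -> \forall x \near F, f x < c) -> f @ F --> l.
Proof.
case: l => [l| |] lo hi.
- move=> V [e /= e0 eV].
  have h1 : \forall x \near F, (l - e)%:E < f x by apply: lo; rewrite lte_fin ltrBlDr ltrDl.
  have h2 : \forall x \near F, f x < (l + e)%:E by apply: hi; rewrite lte_fin ltrDl.
  apply: filterS2 h1 h2 => x; rewrite /preimage/=; case: (f x) => [z| |] //; rewrite !lte_fin => z1 z2.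
  by apply: eV; rewrite /ball_/= ltr_distlC; apply/andP.
- by apply/cvgeyPgt => M; apply: lo; exact: ltry.
- by apply/cvgeNyPlt => M; apply: hi; exact: ltNyr.
Qed.

Lemma ereal_between {R : realType} (c : \bar R) (r : R) : c < r%:E ->
  exists2 r', c < r'%:E & (r' < r)%R.
Proof.
case: c => [c| //|]; last by exists (r - 1)%R; rewrite ?ltNyr// ltrBlDr ltrDl.
rewrite lte_fin => cr; exists ((c + r) / 2)%R; rewrite ?lte_fin; lra.
Qed.

Lemma ereal_between_gt {R : realType} (r : R) (c : \bar R) : r%:E < c ->
  exists2 r', (r < r')%R & r'%:E < c.
Proof.
case: c => [c| |//]; last by exists (r + 1)%R; rewrite ?ltry// ltrDl.
rewrite lte_fin => cr; exists ((r + c) / 2)%R; rewrite ?lte_fin; lra.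
Qed.

Section phase_transition.
Context {d} {T : measurableType d} {R : realType} (P : probability T R).
Variables A B : T -> R.
Hypotheses (mA : measurable_fun [set: T] A) (A0 : forall w, (0 <= A w)%R).
Hypothesis PA : 0 < P [set w | (0 < A w)%R].
Hypotheses (mB : measurable_fun [set: T] B) (B0 : forall w, (0 <= B w)%R).
Hypothesis B_diffuse : forall b : R, P [set w | B w = b] = 0.
(** [B_back] and [drift] are the forms in which P(B > A) > 0 and the load condition enter;
    [backloggable_of_lt] and [drift_feasible] supply them. *)
Hypothesis B_back : backloggable P A B.
Hypothesis drift : exists r s : R, (0 < r)%R /\ feasible P A B r s.
Implicit Types (X : T -> R) (y r s : R).

Local Notation G y := (busy_decay P A (truncated B y)).

Let mtr y : measurable_fun setT (truncated B y).
Proof. exact: measurable_truncated. Qed.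

Let tr0 y w : (0 <= truncated B y w)%R.
Proof. exact: truncated_ge0. Qed.

Lemma feasible_busy_decay X r s : measurable_fun setT X -> (forall w, 0 <= X w)%R ->
  feasible P A X r s -> r%:E <= busy_decay P A X.
Proof.
by move=> mX X0 h; rewrite busy_decayE//; apply: ereal_sup_ubound; exists r => //; exists s.
Qed.

Lemma lt_busy_decay X (c : \bar R) : measurable_fun setT X -> (forall w, 0 <= X w)%R ->
  c < busy_decay P A X -> exists r s, c < r%:E /\ feasible P A X r s.
Proof.
by move=> mX X0; rewrite busy_decayE// => /ereal_sup_gt[_ [r [s h] <-] cr]; exists r, s.
Qed.

Lemma busy_decay_le X Y : measurable_fun setT X -> (forall w, 0 <= X w)%R ->
  measurable_fun setT Y -> (forall w, X w <= Y w)%R ->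
  busy_decay P A Y <= busy_decay P A X.
Proof.
move=> mX X0 mY XY; have Y0 w : (0 <= Y w)%R by exact: le_trans (XY w).
rewrite busy_decayE// busy_decayE//; apply: ereal_sup_le => _ [r [s h] <-].
exists r => //; exists s; exact: (feasible_mono P A mA A0 Y mY X r r s).
Qed.

Lemma busy_decay_truncated_le y y' : (y <= y')%R -> G y' <= G y.
Proof. by move=> yy'; apply: busy_decay_le => // w; exact: truncated_le. Qed.

Lemma busy_decay_le_truncated y : busy_decay P A B <= G y.
Proof. by apply: busy_decay_le => // w; exact: truncated_le_id. Qed.

Lemma busy_decay_gt0 X : measurable_fun setT X -> (forall w, 0 <= X w <= B w)%R ->
  0 < busy_decay P A X.
Proof.
move=> mX XB; have [r [s [r0 h]]] := drift.
apply: (@lt_le_trans _ _ r%:E); first by rewrite lte_fin.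
apply: (@le_trans _ _ (busy_decay P A B)); first exact: feasible_busy_decay h.
by apply: busy_decay_le => // w; have /andP[] := XB w.
Qed.

Lemma backloggable_of_lty y : (0 < y)%R -> G y < +oo -> backloggable P A (truncated B y).
Proof.
move=> y0 Gy; apply: contrapT => h.
by rewrite (not_backloggable_busy_decay P A mA A0 PA B mB B0 B_diffuse y y0 h) ltxx in Gy.
Qed.

(** Lowering a feasible value while staying above [c] makes the inequality strict, which leaves room
    to raise [y]. *)
Lemma busy_decay_truncated_right y (c : \bar R) : (0 < y)%R -> c < G y ->
  exists2 y', (y < y')%R & c < G y'.
Proof.
move=> y0 /lt_busy_decay[|//|r1 [s [cr1 h]]]; first exact: mtr.
have [r cr rr1] := ereal_between _ _ cr1.
have rs : (r <= s)%R.
  by rewrite (le_trans (ltW rr1))// (feasible_le P A mA A0 PA _ (mtr y) (tr0 y) _ _ h).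
have lt1 := feasible_strict P A mA A0 PA _ _ _ _ (mtr y) (tr0 y) rr1 h.
have [y' yy' h'] := truncated_feasible_right P A mA A0 B mB B_diffuse y r s y0 h.1 rs lt1.
by exists y' => //; apply: lt_le_trans cr _; exact: feasible_busy_decay h'.
Qed.

Lemma feasible_of_lt X r : measurable_fun setT X -> (forall w, 0 <= X w)%R ->
  r%:E < busy_decay P A X -> exists s, feasible P A X r s.
Proof.
move=> mX X0 /lt_busy_decay[//|//|r' [s [rr' h]]]; exists s.
by apply: (feasible_mono P A mA A0 X mX X r' r s) => //; apply: ltW; rewrite -lte_fin.
Qed.

(** Otherwise some real r in (G y, c) is feasible at all smaller levels, hence at [y] by left
    limits. Finiteness of [G y] guarantees that the truncated queue is backloggable. *)
Lemma busy_decay_truncated_left y (c : \bar R) : (0 < y)%R -> G y < c ->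
  exists2 y', (0 < y' < y)%R & G y' < c.
Proof.
move=> y0 Gc; have sep := backloggable_of_lty y y0 (lt_le_trans Gc (leey _)).
have [r0 [s0 [r00 Gr0 _]]] := busy_decay_attained P A mA A0 PA _ (mtr y) (tr0 y) sep.
rewrite Gr0 in Gc; have [r r0r rc] := ereal_between_gt r0 c Gc.
apply: contrapT => /forall2NP h.
have [s hs] : exists s, feasible P A (truncated B y) r s.
  apply: truncated_feasible_left => // [|y' y'y]; first exact: le_trans (ltW r0r).
  apply: feasible_of_lt => //; apply: (lt_le_trans rc); rewrite leNgt; apply/negP.
  by case: (h y').
have := feasible_busy_decay _ _ _ (mtr y) (tr0 y) hs.
by rewrite Gr0 lee_fin leNgt r0r.
Qed.

Lemma busy_decay_truncated_pinfty (c : \bar R) : busy_decay P A B < c ->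
  exists2 y, (0 < y)%R & G y < c.
Proof.
have [r0 [s0 [r00 Gr0 _]]] := busy_decay_attained P A mA A0 PA _ mB B0 B_back.
rewrite Gr0 => Gc; have [r r0r rc] := ereal_between_gt r0 c Gc.
apply: contrapT => /forall2NP h.
have [s hs] : exists s, feasible P A B r s.
  apply: truncated_feasible_pinfty => // [|y y_gt0]; first exact: le_trans (ltW r0r).
  apply: feasible_of_lt => //; apply: (lt_le_trans rc); rewrite leNgt; apply/negP.
  by case: (h y).
have := feasible_busy_decay _ _ _ mB B0 hs.
by rewrite Gr0 lee_fin leNgt r0r.
Qed.

(** Take s = r + 1, so that Phi_A is evaluated at -1 with value a < 1, and choose [y] with e^{y(r +
    1)} = 1 / a. *)
Lemma busy_decay_truncated_at0 (M : R) : exists2 y, (0 < y)%R & M%:E < G y.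
Proof.
pose r := Num.max (M + 1)%R 0%R.
have r0 : (0 <= r)%R by rewrite le_max lexx orbT.
have Mr : (M < r)%R by rewrite lt_max ltrDl ltr01.
have N1 : (-1 <= 0 :> R)%R by rewrite oppr_le0.
pose a := fine ('M_P A (-1)%R).
have aE : 'M_P A (-1)%R = a%:E by rewrite fineK// interarrival_mgf_fin.
have a0 : (0 < a)%R by exact: fine_interarrival_mgf_gt0.
have a1 : (a < 1)%R.
  rewrite -lte_fin -aE -(mgf0 P A) mgf_ltr//; last by rewrite aE ltry.
have lna : (0 < - ln a)%R by rewrite oppr_gt0 ln_lt0// a0.
have r1 : (0 < r + 1)%R by rewrite ltr_wpDl.
pose y := (- ln a / (r + 1))%R.
have y0 : (0 < y)%R by rewrite divr_gt0.
exists y => //; apply: (@lt_le_trans _ _ r%:E); first by rewrite lte_fin.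
apply: (@feasible_busy_decay _ _ (r + 1)%R) => //; split; first exact: ltW.
rewrite opprD addrA subrr add0r aE.
apply: (@le_trans _ _ (a%:E * 'M_P (fun=> y) (r + 1)%R)).
  rewrite lee_pmul2l// ?lte_fin//; apply: mgf_le => // w.
  by rewrite ler_wpM2r ?(ltW r1)// truncated_bound// ltW.
by rewrite mgf_cst /y divfK ?gt_eqF// expRN lnK ?posrE// -EFinM divff// gt_eqF.
Qed.

(** Since [G] is nonincreasing, a lower bound need only be secured to the right of [y] and an upper
    bound to the left. *)
Lemma busy_decay_truncated_continuous y : (0 < y)%R -> G z @[z --> y] --> G y.
Proof.
move=> y0; apply: cvge_order => c cG.
- have [y' yy' cG'] := busy_decay_truncated_right y c y0 cG.
  near=> z; apply: (lt_le_trans cG'); apply: busy_decay_truncated_le.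
  by near: z; exact: (cvgr_le y cvg_id).
- have [y' /andP[_ y'y] cG'] := busy_decay_truncated_left y c y0 cG.
  near=> z; apply: le_lt_trans cG'; apply: busy_decay_truncated_le.
  by near: z; exact: (cvgr_ge y cvg_id).
Unshelve. all: by end_near. Qed.

Lemma busy_decay_truncated_cvg_pinfty : G y @[y --> +oo%R] --> busy_decay P A B.
Proof.
apply: cvge_order => c cG.
- by apply: nearW => y; apply: (lt_le_trans cG); exact: busy_decay_le_truncated.
- have [y' _ cG'] := busy_decay_truncated_pinfty c cG.
  near=> z; apply: le_lt_trans cG'; apply: busy_decay_truncated_le.
  by near: z; apply: nbhs_pinfty_ge; exact: num_real.
Unshelve. all: by end_near. Qed.

Lemma busy_decay_truncated_cvg_at0 : G y @[y --> 0^'+] --> +oo.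
Proof.
apply/cvgeyPgt => M; have [y y0 My] := busy_decay_truncated_at0 M.
near=> z; apply: (lt_le_trans My); apply: busy_decay_truncated_le.
by near: z; exact: nbhs_right_le.
Unshelve. all: by end_near. Qed.

(** At the pair (r, s) attained for [y2], drift gives s > r > 0. Truncating at [y1] strictly lowers
    the service transform at s, and the slack allows a larger r. *)
Lemma busy_decay_truncated_lt y1 y2 : (0 < y1)%R -> (y1 < y2)%R ->
  0 < P [set w | (y1 <= B w < y2)%R] -> backloggable P A (truncated B y2) ->
  G y2 < G y1.
Proof.
move=> y10 y12 Py sep.
have [r [s [r0 Gr h]]] := busy_decay_attained P A mA A0 PA _ (mtr y2) (tr0 y2) sep.
have r_gt0 : (0 < r)%R.
  rewrite -lte_fin -Gr; apply: busy_decay_gt0 => // w.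
  by rewrite tr0 truncated_le_id.
have s_gt0 : (0 < s)%R.
  exact: lt_le_trans (feasible_le P A mA A0 PA _ (mtr y2) (tr0 y2) _ _ h).
have rs := feasible_lt P A mA A0 PA _ (mtr y2) (tr0 y2) _ _
  (backloggable_pos P A A0 _ (mtr y2) sep) s_gt0 h.
have le12 w : (truncated B y1 w * s <= truncated B y2 w * s)%R.
  by rewrite ler_wpM2r ?(ltW s_gt0)// truncated_le// ltW.
have lt12 : 'M_P (truncated B y1) s < 'M_P (truncated B y2) s.
  apply: mgf_lt => //; last first.
    rewrite (le_lt_trans (mgf_le _ _ _ _ _ _ _ le12))// ltey_eq.
    by rewrite (feasible_fin P A mA A0 PA _ (mtr y2) (tr0 y2) _ _ h).
  apply: (lt_le_trans Py); apply: le_measure; rewrite ?inE.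
  - rewrite (_ : [set w | _] = [set w | (y1 <= B w)%R] `&` [set w | (B w < y2)%R]).
      by apply: measurableI; [exact: measurable_ger|exact: measurable_ltr].
    by apply/seteqP; split => w /=; [move/andP|move/andP].
  - by rewrite -[X in measurable X]setTI; apply: measurable_fun_ltr => //;
      exact: measurable_funM.
  - move=> w /= /andP[y1B By2]; rewrite ltr_pM2r// !truncatedE By2.
    by rewrite ifF ?(lt_le_trans y10)//; apply/negbTE; rewrite -leNgt.
have [|r' rr' h'] := feasible_improve P A mA A0 _ _ _ (mtr y1) (tr0 y1) h.1 rs.
  apply: lt_le_trans h.2; rewrite lte_pmul2l ?mgf_gt0//.
  by rewrite interarrival_mgf_fin// subr_le0 ltW.
rewrite Gr; apply: (@lt_le_trans _ _ r'%:E); first by rewrite lte_fin.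
exact: feasible_busy_decay h'.
Qed.

(** At the attained pair r < s, lowering r to 0 puts s in the set defining the workload rate.
    Positive members of that set are witnesses for r = 0, hence bounded. *)
Lemma workload_decay_real : exists2 g : R, workload_decay P A B = g%:E &
  busy_decay P A B < g%:E.
Proof.
have [r [s [r0 Gr h]]] := busy_decay_attained P A mA A0 PA _ mB B0 B_back.
have r_gt0 : (0 < r)%R by rewrite -lte_fin -Gr busy_decay_gt0// => w; rewrite B0 lexx.
have rs := feasible_lt P A mA A0 PA _ mB B0 _ _ (backloggable_pos P A A0 _ mB B_back)
  (lt_le_trans r_gt0 (feasible_le P A mA A0 PA _ mB B0 _ _ h)) h.
have [q [q' [qq' Pq Pq']]] := B_back.
have [S hS] := feasible_bounded P A mA A0 PA _ q q' qq' Pq Pq' mB.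
have lo : r%:E < workload_decay P A B.
  apply: (@lt_le_trans _ _ s%:E); first by rewrite lte_fin.
  apply: ereal_sup_ubound; exists s => //=.
  have := (feasible_mono P A mA A0 B mB B r 0%R s mB (fun=> lexx _) r0 h).2.
  by rewrite sub0r.
have hi : workload_decay P A B <= (Num.max S 0%R)%:E.
  apply: ge_ereal_sup => _ [t /= ht <-]; rewrite lee_fin le_max.
  have [t0|t0] := leP t 0%R; first by rewrite orbT.
  by rewrite (hS B 0%R t)//; split; [exact: ltW|rewrite sub0r].
exists (fine (workload_decay P A B)).
  rewrite fineK// fin_real// (lt_trans _ lo) ?ltNyr//=.
  by rewrite (le_lt_trans hi)// ltry.
rewrite fineK ?Gr// fin_real// (lt_trans _ lo) ?ltNyr//=.
by rewrite (le_lt_trans hi)// ltry.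
Qed.

(** An intermediate value argument for a function that may be infinite: at the supremum of the
    levels with G y >= g, either strict inequality contradicts a one-sided continuity lemma. *)
Lemma critical_truncation_exists (g : R) : busy_decay P A B < g%:E ->
  exists2 y, (0 < y)%R & G y = g%:E.
Proof.
move=> Bg; have [y0 y00 gy0] := busy_decay_truncated_at0 g.
have [y1 y10 y1g] := busy_decay_truncated_pinfty _ Bg.
pose E := [set y : R | g%:E <= G y].
have E0 : E y0 by exact: ltW.
have Eub : ubound E y1.
  move=> y Ey; rewrite leNgt; apply/negP => y1y.
  have := le_lt_trans (le_trans Ey (busy_decay_truncated_le _ _ (ltW y1y))) y1g.
  by rewrite ltxx.
have supE : has_sup E by split; [exists y0|exists y1].
have supE0 : (0 < sup E)%R by apply: (lt_le_trans y00); apply: sup_ubound => //; exact: supE.2.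
exists (sup E) => //; apply/eqP; rewrite eq_le; apply/andP; split; rewrite leNgt; apply/negP => h.
- have [y' yy' gy'] := busy_decay_truncated_right _ _ supE0 h.
  have : (y' <= sup E)%R by apply: sup_ubound; [exact: supE.2|exact: ltW].
  by rewrite leNgt yy'.
- have [y' /andP[_ yy'] gy'] := busy_decay_truncated_left _ _ supE0 h.
  have [|e Ee] := @sup_adherent _ E (sup E - y')%R _ supE; first by rewrite subr_gt0.
  rewrite subKr => y'e.
  have := le_lt_trans (le_trans Ee (busy_decay_truncated_le _ _ (ltW y'e))) gy'.
  by rewrite ltxx.
Qed.

End phase_transition.

(** * Positive drift *)

Section drift.
Context {d} {T : measurableType d} {R : realType} (P : probability T R).
Implicit Types (X Y : T -> R) (s t m : R).

Lemma meanE X : 'E_P[X] = \int[P]_w (X w)%:E.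
Proof. by rewrite unlock. Qed.

Lemma mean_gt0P X : measurable_fun setT X -> (forall w, 0 <= X w)%R ->
  0 < 'E_P[X] <-> 0 < P [set w | (0 < X w)%R].
Proof.
move=> mX X0; have mE : measurable_fun setT (fun w => (X w)%:E) by exact/measurable_EFinP.
have absE : \int[P]_w `|(X w)%:E| = 'E_P[X].
  by rewrite meanE; apply: eq_integral => w _ /=; rewrite ger0_norm.
have mean_ge0 : 0 <= 'E_P[X] by rewrite -absE integral_ge0.
split => h; rewrite lt_neqAle ?measure_ge0 ?mean_ge0 andbT; apply/eqP => h0.
- move: h; rewrite -absE; rewrite (_ : \int[P]_w _ = 0) ?ltxx//.
  apply/(ae_eq_integral_abs P measurableT mE).
  exists [set w | (0 < X w)%R]; split => //; first exact: measurable_gtr.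
  move=> w /= Xw; rewrite lt_neqAle X0 andbT; apply/eqP => Xw0.
  by apply: Xw => _; rewrite -Xw0.
- move: h0; rewrite -absE => /esym/(ae_eq_integral_abs P measurableT mE)[N [mN N0 XN]].
  have : P [set w | (0 < X w)%R] <= P N.
    apply: le_measure; rewrite ?inE//; first exact: measurable_gtr.
    move=> w /= Xw; apply: XN => /= /(_ I) [] Xw0.
    by rewrite Xw0 ltxx in Xw.
  by rewrite N0 leNgt h.
Qed.

Lemma measurable_mul_exp X s : measurable_fun setT X ->
  measurable_fun setT (fun w => (X w * expR (X w * s))%:E).
Proof.
move=> mX; apply/measurable_EFinP; apply: measurable_funM => //.
exact/measurable_EFinP/measurable_exp_mul.
Qed.

(* Integrated form of e^{-x} (1 + x) <= 1. *)
Lemma mgf_le_tangent_neg X t m : measurable_fun setT X -> (forall w, 0 <= X w)%R ->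
  (0 < t)%R -> m%:E < \int[P]_w (X w * expR (X w * - t))%:E ->
  'M_P X (- t)%R <= (1 - m * t)%:E.
Proof.
move=> mX X0 t0 mt; have mf := measurable_mul_exp X (- t) mX.
have f0 w : 0 <= (X w * expR (X w * - t))%:E by rewrite lee_fin mulr_ge0 ?expR_ge0.
rewrite EFinB leeBrDr//; apply: (@le_trans _ _
    ('M_P X (- t)%R + t%:E * \int[P]_w (X w * expR (X w * - t))%:E)).
  by rewrite leeD2l// (mulrC m) EFinM lee_pmul2l ?lte_fin// ltW.
rewrite -ge0_integralZl//; last by rewrite lee_fin ltW.
rewrite mgfE -ge0_integralD//; last 3 first.
- exact: measurable_exp_mul.
- by move=> w _; rewrite mule_ge0// lee_fin ltW.
- by apply: measurable_funeM.
apply: (@le_trans _ _ (\int[P]_w (cst 1 w))); last first.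
  by rewrite integral_cst// [X in _ * X]probability_setT mul1e.
apply: ge0_le_integral => //.
- move=> w _; apply: adde_ge0; first by rewrite lee_fin expR_ge0.
  by apply: mule_ge0 => //; rewrite lee_fin ltW.
- apply: emeasurable_funD; first exact: measurable_exp_mul.
  exact: measurable_funeM.
- move=> w _ /=; rewrite -EFinM -EFinD lee_fin.
  have := expR_ge1Dx (X w * t); rewrite mulrN expRN => h.
  have e0 := expR_gt0 (X w * t).
  rewrite (_ : _ + _ = (1 + X w * t) / expR (X w * t))%R; last by field; rewrite gt_eqF.
  by rewrite ler_pdivrMr// mul1r.
Qed.

(* Integrated form of e^x (1 - x) <= 1. *)
Lemma mgf_le_tangent_pos X s m : measurable_fun setT X -> (forall w, 0 <= X w)%R ->
  (0 < s)%R -> \int[P]_w (X w * expR (X w * s))%:E < m%:E ->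
  'M_P X s <= (1 + m * s)%:E.
Proof.
move=> mX X0 s0 ms; have mf := measurable_mul_exp X s mX.
have f0 w : 0 <= (X w * expR (X w * s))%:E by rewrite lee_fin mulr_ge0 ?expR_ge0.
apply: (@le_trans _ _ (1 + s%:E * \int[P]_w (X w * expR (X w * s))%:E)); last first.
  by rewrite EFinD leeD2l// (mulrC m) EFinM lee_pmul2l ?lte_fin// ltW.
rewrite -ge0_integralZl//; last by rewrite lee_fin ltW.
have -> : 1 = \int[P]_w (cst 1 w).
  by rewrite integral_cst// [X in _ * X]probability_setT mul1e.
rewrite mgfE -ge0_integralD//; last 2 first.
- by move=> w _; rewrite mule_ge0// lee_fin ltW.
- by apply: measurable_funeM.
apply: ge0_le_integral => //.
- exact: measurable_exp_mul.
- by apply: emeasurable_funD => //; exact: measurable_funeM.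
- move=> w _ /=; rewrite -EFinM -EFinD lee_fin.
  have := expR_ge1Dx (- (X w * s)); rewrite expRN => h.
  have e0 := expR_gt0 (X w * s).
  rewrite -lerBlDr (_ : _ - _ = (1 + - (X w * s)) * expR (X w * s))%R; last by ring.
  by rewrite -ler_pdivlMr// mul1r.
Qed.

(** By Fatou; the mean of [X] is allowed to be infinite. *)
Lemma tilted_mean_gt X (t_ : R^nat) m : measurable_fun setT X ->
  (forall w, 0 <= X w)%R -> (t_ n @[n --> \oo] --> 0)%R -> m%:E < 'E_P[X] ->
  \forall n \near \oo, m%:E < \int[P]_w (X w * expR (X w * - t_ n))%:E.
Proof.
move=> mX X0 ct mE.
pose f n w := (X w * expR (X w * - t_ n))%:E.
have f0 n w : 0 <= f n w by rewrite lee_fin mulr_ge0 ?expR_ge0.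
have := fatou P measurableT (fun n => measurable_mul_exp X (- t_ n) mX) (fun n w _ => f0 n w).
have -> : \int[P]_w limn_einf (fun n => f n w) = 'E_P[X].
  rewrite meanE; apply: eq_integral => w _.
  have cw : f n w @[n --> \oo] --> (X w)%:E.
    apply: cvg_EFin; first exact: nearW.
    rewrite -[X in _ --> X]mulr1; apply: cvgMr.
    rewrite -expR0 -(mulr0 (X w)) -oppr0; apply: continuous_cvg; first exact: continuous_expR.
    by apply: cvgMr; apply: cvgN.
  by rewrite (cvg_limn_einf_sup cw).1.
move=> /(lt_le_trans mE); rewrite limn_einf_lim => h.
have := is_cvg_einfs (u := fun n => \int[P]_w f n w).
move=> c.
have [N _ hN] := c _ (open_ereal_gt' h).
exists N => // n /= Nn; apply: (lt_le_trans (hN n Nn)).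
by apply: ereal_inf_lbound; exists n => /=.
Qed.

(** Since e x <= exp(e x), the integrands are dominated by exp(2 e X) / e. *)
Lemma tilted_mean_lt X (s_ : R^nat) (e m : R) : measurable_fun setT X ->
  (forall w, 0 <= X w)%R -> (0 < e)%R -> 'M_P X (e + e)%R < +oo ->
  (forall n, s_ n <= e)%R -> (s_ n @[n --> \oo] --> 0)%R -> 'E_P[X] < m%:E ->
  \forall n \near \oo, \int[P]_w (X w * expR (X w * s_ n))%:E < m%:E.
Proof.
move=> mX X0 e0 Me se cs mE.
pose f n w := (X w * expR (X w * s_ n))%:E.
have [] := @dominated_convergence _ _ _ P setT measurableT f (fun w => (X w)%:E)
  (fun w => e^-1%:E * (expR (X w * (e + e)))%:E).
- by move=> n; exact: measurable_mul_exp.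
- exact/measurable_EFinP.
- apply: aeW => w _; apply: cvg_EFin; first exact: nearW.
  rewrite -[X in _ --> X]mulr1; apply: cvgMr.
  rewrite -expR0 -(mulr0 (X w)); apply: continuous_cvg; first exact: continuous_expR.
  exact: cvgMr.
- apply: integrableZl => //; apply/integrableP; split; first exact: measurable_exp_mul.
  apply: le_lt_trans Me; rewrite mgfE le_eqVlt; apply/orP; left; apply/eqP.
  by apply: eq_integral => w _ /=; rewrite ger0_norm ?expR_ge0.
- apply: aeW => w n _; rewrite /f /= lee_fin ger0_norm ?mulr_ge0 ?expR_ge0//.
  rewrite mulrDr expRD mulrA; apply: ler_pM => //; rewrite ?expR_ge0//; last first.
    by rewrite ler_expR ler_wpM2l.
  rewrite ler_pdivlMl// mulrC; apply: le_trans (expR_ge1Dx _); lra.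
move=> _ _ /(_ _ (open_ereal_lt' _)); rewrite -meanE; exact.
Qed.

(** Choose E(B) < m1 < m2 < E(A). For small s and t the tangent bounds are 1 + m1 s and 1 - m2 t;
    with m2 t = m1 s their product is 1 - (m1 s)^2 <= 1, and r = s - t > 0. *)
Lemma drift_feasible (A B : T -> R) :
  measurable_fun setT A -> (forall w, 0 <= A w)%R ->
  measurable_fun setT B -> (forall w, 0 <= B w)%R ->
  light_tailed P B -> 'E_P[B] < 'E_P[A] ->
  exists r s, (0 < r)%R /\ feasible P A B r s.
Proof.
move=> mA A0 mB B0 [e0 e00 hB] BA.
have EB0 : 0 <= 'E_P[B] by rewrite meanE integral_ge0// => w _; rewrite lee_fin.
have EBf : 'E_P[B] \is a fin_num by rewrite ge0_fin_numE// (lt_le_trans BA)// leey.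
rewrite -(fineK EBf) in BA.
have [m2 cm2 m2A] := ereal_between_gt _ _ BA.
pose c := fine 'E_P[B]; have c0 : (0 <= c)%R by rewrite fine_ge0.
pose m1 := ((c + m2) / 2)%R.
have cm1 : (c < m1)%R by rewrite /m1 /c in cm2 *; lra.
have m12 : (m1 < m2)%R by rewrite /m1 /c in cm2 *; lra.
have m1_gt0 : (0 < m1)%R by exact: le_lt_trans cm1.
have m2_gt0 : (0 < m2)%R by exact: lt_trans m12.
(* Dividing by 3 keeps 2e inside the light-tail neighbourhood. *)
pose e := (e0 / 3)%R; have e_gt0 : (0 < e)%R by rewrite divr_gt0.
pose s_ n := (e * n.+1%:R^-1)%R; pose t_ n := (e * m1 / m2 * n.+1%:R^-1)%R.
have cs : (s_ n @[n --> \oo] --> 0)%R.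
  by rewrite -[X in _ --> X](mulr0 e); apply: cvgMr; exact: cvg_harmonic.
have ct : (t_ n @[n --> \oo] --> 0)%R.
  by rewrite -[X in _ --> X](mulr0 (e * m1 / m2)%R); apply: cvgMr; exact: cvg_harmonic.
have s0 n : (0 < s_ n)%R by rewrite mulr_gt0// invr_gt0.
have t0 n : (0 < t_ n)%R by rewrite /t_ divr_gt0// divr_gt0// mulr_gt0.
have se n : (s_ n <= e)%R.
  by rewrite ger_pMr//; have /andP[] := harmonic_itv (R := R) n.
have Me : 'M_P B (e + e)%R < +oo.
  by apply: hB; rewrite ger0_norm ?addr_ge0 ?ltW// /e; lra.
have mB1 : 'E_P[B] < m1%:E by rewrite -(fineK EBf) lte_fin.
have h1 := tilted_mean_gt A t_ m2 mA A0 ct m2A.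
have h2 := tilted_mean_lt B s_ e m1 mB B0 e_gt0 Me se cs mB1.
have [n [/= hA hB']] := filter_ex (filterI h1 h2).
have stE : (m2 * t_ n = m1 * s_ n)%R.
  have m2_neq0 : m2 != 0%R by rewrite gt_eqF.
  by rewrite /t_ /s_; set k := (n.+1%:R^-1)%R; field.
exists (s_ n - t_ n)%R, (s_ n); split.
  have := s0 n; have := t0 n; nra.
split; first exact: ltW.
rewrite addrAC subrr sub0r.
apply: (le_trans (lee_pmul (mgf_ge0 _ _ _) (mgf_ge0 _ _ _)
  (mgf_le_tangent_neg _ _ _ mA A0 (t0 n) hA) (mgf_le_tangent_pos _ _ _ mB B0 (s0 n) hB'))).
by rewrite -EFinM lee_fin stE; have := sqr_ge0 (m1 * s_ n)%R; nra.
Qed.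

(** The conventions on division matter: if E(A) = 0 the load is +oo, which is excluded; if E(A) =
    +oo the claim is finiteness of E(B). *)
Lemma mean_lt_of_load (A B : T -> R) : 0 <= 'E_P[A] -> 0 < 'E_P[B] ->
  'E_P[B] < +oo -> load P A B < 1 -> 'E_P[B] < 'E_P[A].
Proof.
rewrite /load; case: ('E_P[A]) => [a| |//].
- rewrite lee_fin le_eqVlt => /orP[/eqP <-|a0] b0 boo; rewrite inver.
    by rewrite eqxx gt0_muley.
  by rewrite gt_eqF// lte_pdivrMr// mul1e.
- by move=> _ b0 boo _.
Qed.

Lemma mean_lty (B : T -> R) : measurable_fun setT B -> (forall w, 0 <= B w)%R ->
  light_tailed P B -> 'E_P[B] < +oo.
Proof.
move=> mB B0 [e e0 hB].
have Me : 'M_P B (e / 2)%R < +oo by apply: hB; rewrite ger0_norm; lra.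
have e2 : (0 < e / 2)%R by rewrite divr_gt0.
apply: (@le_lt_trans _ _ (((e / 2)^-1)%:E * 'M_P B (e / 2)%R)).
  rewrite mgfE meanE -ge0_integralZl//; last 2 first.
  - exact: measurable_exp_mul.
  - by rewrite lee_fin invr_ge0 ltW.
  apply: ge0_le_integral => //.
  - by move=> w _; rewrite lee_fin.
  - exact/measurable_EFinP.
  - by apply: measurable_funeM; exact: measurable_exp_mul.
  - move=> w _; rewrite -EFinM lee_fin ler_pdivlMl// mulrC.
    by apply: le_trans (expR_ge1Dx _); rewrite lerDr.
by rewrite lte_mul_pinfty// lee_fin invr_ge0 ltW.
Qed.

End drift.

(** * Replacing random variables by almost surely equal ones *)

Section almost_everywhere.
Context {d} {T : measurableType d} {R : realType} (P : probability T R).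
Implicit Types (X Y A B : T -> R) (s y : R).

Lemma ae_prob_le (E F : set T) : measurable E -> measurable F ->
  {ae P, forall w, E w -> F w} -> P E <= P F.
Proof.
move=> mE mF [N [mN N0 EF]]; rewrite -[leRHS]adde0 -[X in _ + X]N0.
apply: (le_trans _ (measureU2 _ mF mN)); apply: le_measure; rewrite ?inE//.
  exact: measurableU.
move=> w Ew; have [Fw|Fw] := pselect (F w); [by left|right].
by apply: EF => /= /(_ Ew).
Qed.

Lemma ae_eq_mgf X Y : measurable_fun setT X -> measurable_fun setT Y ->
  {ae P, forall w, X w = Y w} -> 'M_P X = 'M_P Y.
Proof.
move=> mX mY XY; apply/funext => s; apply/eqP; rewrite eq_le; apply/andP; split.
  by apply: ae_mgf_le => //; apply: filterS XY => w ->.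
by apply: ae_mgf_le => //; apply: filterS XY => w ->.
Qed.

Lemma ae_eq_mean X Y : measurable_fun setT X -> measurable_fun setT Y ->
  {ae P, forall w, X w = Y w} -> 'E_P[X] = 'E_P[Y].
Proof.
move=> mX mY XY; rewrite !meanE; apply: ae_eq_integral => //.
- exact/measurable_EFinP.
- exact/measurable_EFinP.
- by apply: filterS XY => w -> _.
Qed.

Lemma ae_eq_busy_decay A A' X X' : 'M_P A = 'M_P A' -> 'M_P X = 'M_P X' ->
  busy_decay P A X = busy_decay P A' X'.
Proof. by rewrite /busy_decay /mgf_inv => -> ->. Qed.

Lemma ae_eq_workload_decay A A' X X' : 'M_P A = 'M_P A' -> 'M_P X = 'M_P X' ->
  workload_decay P A X = workload_decay P A' X'.
Proof. by rewrite /workload_decay => -> ->. Qed.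

Lemma density_diffuse (B : {RV P >-> R}) : has_density B ->
  forall b : R, P [set w | B w = b] = 0.
Proof.
move=> [f [_ _ hf]] b; have := hf [set b] (measurable_set1 b).
by rewrite integral_set1.
Qed.

End almost_everywhere.

(** * Reduction to nonnegative versions and the phase transition *)

Theorem mainTheorem6 (R : realType) (d : measure_display)
    (T : measurableType d) (P : probability T R) (A B : {RV P >-> R})
    (A_ge0 : {ae P, forall w, (0 <= A w)%R})
    (B_ge0 : {ae P, forall w, (0 <= B w)%R})
    (AB_indep : independent_RVs A B)
    (rho_lt1 : load P A B < 1)
    (BA_pos : 0 < P [set w | (A w < B w)%R])
    (B_light : light_tailed P B)
    (B_density : has_density B) :
  let gammaw := workload_decay P A B in
  let gammap := busy_decay P A B in
  let gammapy := fun y : R => busy_decay P A (truncated B y) in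
  [/\ (* continuity on (0, +oo), for the topology of the extended reals *)
      forall y : R, (0 < y)%R -> gammapy z @[z --> y] --> gammapy y,
      (* monotonicity; strict between y1 and y2 as soon as the truncations at
         y1 and y2 do not coincide almost surely, on the range of y where the
         truncated queue can build up work *)
      forall y1 y2 : R, (0 < y1)%R -> (y1 < y2)%R ->
        gammapy y2 <= gammapy y1 /\
        (0 < P [set w | (y1 <= B w < y2)%R] ->
         0 < P [set w | (A w < truncated B y2 w)%R] ->
         gammapy y2 < gammapy y1),
      (* limits at +oo and at 0 *)
      gammapy y @[y --> +oo%R] --> gammap /\ gammap < gammaw,
      gammapy y @[y --> 0^'+] --> +oo
    & (* critical value *)
      exists ystar : R,
        [/\ (0 < ystar)%R,
            gammapy ystar = gammaw,
            forall y : R, (0 < y)%R -> (y < ystar)%R ->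
              0 < P [set w | (y <= B w < ystar)%R] -> gammaw < gammapy y
          & forall y : R, (ystar < y)%R ->
              0 < P [set w | (ystar <= B w < y)%R] -> gammapy y < gammaw]].
Proof.
move=> gammaw gammap gammapy.
have mA : measurable_fun setT A by exact: measurable_funPT.
have mB : measurable_fun setT B by exact: measurable_funPT.
(* Positive parts are nonnegative everywhere and change nothing almost surely, so all transforms and
   decay rates agree. *)
pose A' w := Num.max (A w) 0%R; pose B' w := Num.max (B w) 0%R.
have mA' : measurable_fun setT A' by exact: measurable_maxr.
have mB' : measurable_fun setT B' by exact: measurable_maxr.
have A0 w : (0 <= A' w)%R by rewrite le_max lexx orbT.
have B0 w : (0 <= B' w)%R by rewrite le_max lexx orbT.
have eA : {ae P, forall w, A w = A' w}.
  by apply: filterS A_ge0 => w Aw; rewrite /A' max_l.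
have eB : {ae P, forall w, B w = B' w}.
  by apply: filterS B_ge0 => w Bw; rewrite /B' max_l.
clearbody A' B'.
have mtr y : measurable_fun setT (truncated B y) by exact: measurable_truncated.
have mtr' y : measurable_fun setT (truncated B' y) by exact: measurable_truncated.
have etr y : {ae P, forall w, truncated B y w = truncated B' y w}.
  by apply: filterS eB => w Bw; rewrite !truncatedE Bw.
have MA := ae_eq_mgf P _ _ mA mA' eA; have MB := ae_eq_mgf P _ _ mB mB' eB.
have gwE : gammaw = workload_decay P A' B' by exact: ae_eq_workload_decay.
have gpE : gammap = busy_decay P A' B' by exact: ae_eq_busy_decay.
have gpyE : gammapy = fun y => busy_decay P A' (truncated B' y).
  by apply/funext => y; apply: ae_eq_busy_decay => //; exact: ae_eq_mgf.
clearbody gammaw gammap gammapy.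
have lt_ae X X' : measurable_fun setT X -> measurable_fun setT X' ->
    {ae P, forall w, X w = X' w} ->
    0 < P [set w | (A w < X w)%R] -> 0 < P [set w | (A' w < X' w)%R].
  move=> mX mX' eX /lt_le_trans; apply; apply: ae_prob_le.
  - by rewrite -[X in measurable X]setTI; exact: measurable_fun_ltr.
  - by rewrite -[X in measurable X]setTI; exact: measurable_fun_ltr.
  - by apply: filterS2 eA eX => w /= <- <-.
have mitv (Y : T -> R) (y1 y2 : R) : measurable_fun setT Y ->
    measurable [set w | (y1 <= Y w < y2)%R].
  move=> mY.
  rewrite (_ : [set w | _] = [set w | (y1 <= Y w)%R] `&` [set w | (Y w < y2)%R]).
    by apply: measurableI; [exact: measurable_ger|exact: measurable_ltr].
  by apply/seteqP; split => w /=; [move/andP|move/andP].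
have itv_ae y1 y2 : 0 < P [set w | (y1 <= B w < y2)%R] ->
    0 < P [set w | (y1 <= B' w < y2)%R].
  move=> /lt_le_trans; apply; apply: ae_prob_le; [exact: mitv|exact: mitv|].
  by apply: filterS eB => w /= <-.
have BA' := lt_ae _ _ mB mB' eB BA_pos.
have back := backloggable_of_lt P A' mA' B' mB' BA'.
have B_diffuse b : P [set w | B' w = b] = 0.
  apply/eqP; rewrite -measure_le0 -(density_diffuse P B B_density b).
  apply: ae_prob_le; [exact: measurable_eqr|exact: measurable_eqr|].
  by apply: filterS eB => w /= <-.
have B_light' : light_tailed P B' by rewrite /light_tailed -MB.
have EB0 : 0 < 'E_P[B'].
  by apply/mean_gt0P => //; exact: (backloggable_pos P A' A0 B' mB' back).
have EA0 : 0 <= 'E_P[A'] by rewrite meanE integral_ge0// => w _; rewrite lee_fin.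
have EBA : 'E_P[B'] < 'E_P[A'].
  apply: mean_lt_of_load => //; first exact: mean_lty.
  by move: rho_lt1; rewrite /load (ae_eq_mean P _ _ mA mA' eA) (ae_eq_mean P _ _ mB mB' eB).
have PA : 0 < P [set w | (0 < A' w)%R] by apply/mean_gt0P => //; exact: lt_trans EBA.
have drift := drift_feasible P A' B' mA' A0 mB' B0 B_light' EBA.
have Gle y1 y2 : (y1 <= y2)%R -> gammapy y2 <= gammapy y1.
  by rewrite gpyE => y12; exact: busy_decay_truncated_le.
have Glt y1 y2 : (0 < y1)%R -> (y1 < y2)%R -> 0 < P [set w | (y1 <= B w < y2)%R] ->
    backloggable P A' (truncated B' y2) -> gammapy y2 < gammapy y1.
  by rewrite gpyE => y10 y12 Py bl; apply: busy_decay_truncated_lt => //; exact: itv_ae.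
have [g gE gp_lt_g] := workload_decay_real P A' B' mA' A0 PA mB' B0 back drift.
have [ystar ystar0 ystarE] := critical_truncation_exists P A' B' mA' A0 PA mB' B0
  B_diffuse back g gp_lt_g.
(* The rate at [ystar] is finite, so work can build up there, and hence at every larger level; this
   yields strictness on both sides. *)
have back_star : backloggable P A' (truncated B' ystar).
  by apply: backloggable_of_lty => //; rewrite ystarE ltry.
have Gstar : gammapy ystar = gammaw by rewrite gpyE gwE gE.
split.
- by rewrite gpyE => y y0; exact: busy_decay_truncated_continuous.
- move=> y1 y2 y10 y12; split; first by apply: Gle; exact: ltW.
  move=> Py PAy; apply: Glt => //; apply: backloggable_of_lt => //.
  exact: lt_ae PAy.
- by rewrite gpyE gpE gwE gE; split => //; exact: busy_decay_truncated_cvg_pinfty.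
- by rewrite gpyE; exact: busy_decay_truncated_cvg_at0.
exists ystar; split => //.
- by move=> y y0 yy Py; rewrite -Gstar; exact: Glt.
- move=> y yy Py; rewrite -Gstar; apply: Glt => //.
  apply: (backloggable_mono P A' (truncated B' ystar)) => // w.
  by apply: truncated_le => //; exact: ltW.
Qed.
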